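(* Let $\alpha>0$ and $\gamma=1/\alpha$. Assume that $U$ satisfies $\lim_{t\to\infty}U(tx)/U(t)=x^{\gamma}$ for every $x>0$, and that there exist $t_0>0$ and $\eta\in[0,1)$ such that $U(tx)/U(t)\ge(1-\eta)x^{\gamma}+\eta$ for all $t\ge t_0$ and $x\ge 1$. Suppose that the network is generated under either the ordered Norros-Reittu model with $\alpha>0$ or the ordered Chung-Lu model with $\alpha>2$. Further suppose that $k(n)$ is such that $k(n)\to\infty$ and $k(n)\,(\log n)^{\alpha}/n^{\frac{1}{4\alpha+1}}\to 0$ as $n\to\infty$. Then, as $n\to\infty$, $$\mathbb{P}\left(\left(R_1(n),R_2(n),\dots,R_{k(n)}(n)\right)=(1,2,\dots,k(n))\right)\to 1 .$$
   Context: Notation: $[n]=\{1,\dots,n\}$ and $x\wedge y=\min(x,y)$. Let $F$ be a continuous distribution function supported on the positive reals, and let $W_1,W_2,\dots,W_n$ be independent with distribution function $F$. Let $W_{(1)}(n)\ge W_{(2)}(n)\ge\dots\ge W_{(n)}(n)$ be their decreasing order statistics and $L(n)=\sum_{i=1}^n W_i$. Let $U(t)=F^{\leftarrow}(1-1/t)$ for $t\ge1$, where $F^{\leftarrow}(y)=\inf\{x:F(x)\ge y\}$. Ordered random graph models on $n$ nodes: $\{A_{ij}(n)\}_{i,j=1}^n$ is a random symmetric adjacency matrix whose entries with $1\le i\le j\le n$ are, conditionally on $\{W_{(i)}(n)\}_{i\in[n]}$, independent. In the (ordered) Norros-Reittu model, $A_{ij}(n)\mid\{W_{(i)}(n)\}_{i\in[n]}\sim\mathrm{Poisson}\left(W_{(i)}(n)W_{(j)}(n)/L(n)\right)$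 for $1\le i\le j\le n$. In the (ordered) Chung-Lu model, $A_{ij}(n)\mid\{W_{(i)}(n)\}_{i\in[n]}\sim\mathrm{Bernoulli}\left(\frac{W_{(i)}(n)W_{(j)}(n)}{L(n)}\wedge1\right)$ for $1\le i\le j\le n$. The degree of node $i$ is $D_i(n)=\sum_{j=1}^n A_{ij}(n)$ (so node $i$ is the node with the $i$-th largest weight). $R_i(n)=\sum_{j=1}^n 1_{\{D_i(n)\le D_j(n)\}}$ is the number of nodes with degree at least as large as that of node $i$. $k(n)$ denotes a sequence of positive integers. *)

(* Defs.v *)
From mathcomp Require Export all_boot all_order all_algebra.
From mathcomp Require Export all_classical all_reals all_analysis.

Set Implicit Arguments.
Unset Strict Implicit.
Unset Printing Implicit Defensive.

Import Order.TTheory GRing.Theory Num.Theory.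
Export numFieldNormedType.Exports.

Local Open Scope classical_set_scope.
Local Open Scope ring_scope.

(** Distribution functions are elements of [cumulativeBounded 0 1]:
    nondecreasing, right-continuous, with limits 0 at -oo and 1 at +oo. *)

Definition quantile (R : realType) (F : R -> R) (y : R) : R :=
  inf [set x | y <= F x].

(** Only the values at [t > 1] are meaningful.  For [t <= 1] the infimum is
    over all of [R] and takes the default value 0. *)
Definition tail_quantile (R : realType) (F : R -> R) (t : R) : R :=
  quantile F (1 - 1 / t).

(** The [i : 'I_n] are 0-based: [order_stat w i] is the [i.+1]-st largest of
    the [n] numbers [w j]. *)
Definition order_stat (R : realType) n (w : 'I_n -> R) (i : 'I_n) : R :=
  nth 0 (sort >=%R (codom w)) i.

Section conditioning.
Context (d : measure_display) (T : measurableType d) (R : realType).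
Variable P : probability T R.

Definition mutually_independent (I : finType) d' (S : measurableType d')
    (X : I -> T -> S) : Prop :=
  forall (J : {set I}) (B : I -> set S), (forall i, measurable (B i)) ->
    P (\bigcap_(i in [set` J]) (X i @^-1` B i))
      = (\prod_(i in J) P (X i @^-1` B i))%E.

(** [Z] is a version of the conditional probability of [E] given the
    sub-sigma-algebra [G]. *)
Definition is_cond_prob (G : set (set T)) (E : set T) (Z : T -> R) : Prop :=
  [/\ forall B : set R, measurable B -> G (Z @^-1` B),
      P.-integrable setT (EFin \o Z) &
      forall H, G H -> (\int[P]_(w in H) (Z w)%:E = P (E `&` H))%E].

(** The conditional law of [X] given [G] is the random measure [nu]. *)
Definition has_cond_law (G : set (set T)) d' (S : measurableType d')
    (X : T -> S) (nu : T -> set S -> \bar R) : Prop :=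
  forall B, measurable B ->
    is_cond_prob G (X @^-1` B) (fun w => fine (nu w B)).

(** Conditional independence given [G] of the family [X i], [i \in D]. Versions
    [Z i] are a.s. unique, so it does not matter which ones are taken. *)
Definition cond_independent (G : set (set T)) (I : finType) (D : {set I})
    d' (S : measurableType d') (X : I -> T -> S) : Prop :=
  forall (J : {set I}) (B : I -> set S) (Z : I -> T -> R),
    J \subset D -> (forall i, measurable (B i)) ->
    (forall i, i \in J -> is_cond_prob G (X i @^-1` B i) (Z i)) ->
    is_cond_prob G (\bigcap_(i in [set` J]) (X i @^-1` B i))
                   (fun w => \prod_(i in J) Z i w).

End conditioning.

Section models.
Context (d : measure_display) (T : measurableType d) (R : realType).
Variables (P : probability T R) (n : nat).

Definition iid_weights (F : R -> R) (W : 'I_n -> {RV P >-> R}) : Prop :=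
  mutually_independent P (fun i => W i : T -> R) /\
  forall i x, cdf (W i) x = (F x)%:E.

Definition ordered_weight (W : 'I_n -> {RV P >-> R}) (i : 'I_n) (w : T) : R :=
  order_stat (fun j => W j w) i.

Definition total_weight (W : 'I_n -> {RV P >-> R}) (w : T) : R :=
  \sum_(i < n) W i w.

Definition edge_intensity (W : 'I_n -> {RV P >-> R}) (i j : 'I_n) (w : T) : R :=
  ordered_weight W i w * ordered_weight W j w / total_weight W w.

(** The sigma-algebra generated by the order statistics. *)
Definition sigma_ordered (W : 'I_n -> {RV P >-> R}) : set (set T) :=
  g_sigma_preimage (ordered_weight W).

Definition ordered_random_graph (F : R -> R) (W : 'I_n -> {RV P >-> R})
    (A : 'I_n -> 'I_n -> {RV P >-> nat})
    (law : R -> set nat -> \bar R) : Prop :=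
  [/\ iid_weights F W,
      forall i j w, A i j w = A j i w,
      cond_independent P (sigma_ordered W)
        [set ij : 'I_n * 'I_n | (ij.1 <= ij.2)%N]
        (fun ij => A ij.1 ij.2 : T -> nat) &
      forall i j : 'I_n, (i <= j)%N ->
        has_cond_law P (sigma_ordered W) (A i j : T -> nat)
          (fun w => law (edge_intensity W i j w))].

(** The [nat] argument of the library's [poisson_prob] is a dummy. *)
Definition norros_reittu (F : R -> R) (W : 'I_n -> {RV P >-> R})
    (A : 'I_n -> 'I_n -> {RV P >-> nat}) : Prop :=
  ordered_random_graph F W A (fun r => poisson_prob r 0).

(** [bernoulli_prob] lives on [bool]; it is transported to {0, 1} in [nat]. *)
Definition chung_lu (F : R -> R) (W : 'I_n -> {RV P >-> R})
    (A : 'I_n -> 'I_n -> {RV P >-> nat}) : Prop :=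
  ordered_random_graph F W A
    (fun r => pushforward (bernoulli_prob (Num.min r 1)) nat_of_bool).

Definition degree (A : 'I_n -> 'I_n -> {RV P >-> nat}) (i : 'I_n) (w : T)
    : nat := (\sum_(j < n) A i j w)%N.

Definition degree_rank (A : 'I_n -> 'I_n -> {RV P >-> nat}) (i : 'I_n) (w : T)
    : nat := (\sum_(j < n) (degree A i w <= degree A j w))%N.

(** The event (R_1, ..., R_k) = (1, ..., k), for [k <= n]. *)
Definition top_ranks_correct (A : 'I_n -> 'I_n -> {RV P >-> nat}) (k : nat)
    : set T :=
  [set w | forall i : 'I_n, (i < k)%N -> degree_rank A i w = i.+1].

End models.

(* Main.v *)
Require Import Defs.
From mathcomp Require Import perm ring lra measurable_realfun.
From mathcomp Require Import random_variable.
From mathcomp Require Import bernoulli_distribution poisson_distribution.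
Import Order.TTheory GRing.Theory Num.Theory.
Import numFieldNormedType.Exports.
Set Implicit Arguments.
Unset Strict Implicit.
Unset Printing Implicit Defensive.
Local Open Scope classical_set_scope.
Local Open Scope ring_scope.

(** Write [w_1 >= w_2 >= ...] for the ordered weights.  Given the weights, the
    expected degree of node [i] is [sum_j w_i w_j / L = w_i], up to truncation
    in the Chung-Lu model, and the degree is a sum of independent variables
    whose generating functions are dominated by those of Poisson variables.  It
    therefore deviates from [w_i] by at most a multiple of [sqrt (w_i log n)],
    simultaneously for all nodes of large weight, while the other degrees stay
    well below.  The ranking of the top [k] nodes is recovered as soon as, for
    [i <= k], the gap [w_i - w_(i+1)] exceeds a large multiple of
    [sqrt (w_i log n)]: some integer [m] then lies between [w_i] and [w_(i+1)],
    far from both, and it separates [D_i] from all the degrees [D_j] with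
    [j > i].

    The gaps.  Let [s = 4 k / n].  By Chebyshev's inequality more than [k]
    weights lie in the upper [s]-tail of [F] ([chebyshev_events]).  The lower
    bound on [U] has two consequences.  First, [U t >= c t^gamma], so these
    weights are at least of order [(n / k)^gamma].  Second, two weights
    [x <= z] of the tail satisfy
    [F z - F x <= C (1 - F x) (z - x) / x] ([cumulative_increment_le]), so two
    weights that are too close have values of [F] that differ by less than
    [s / M], where [M] is of order [(n / k)^(gamma / 2) / sqrt (log n)].  As
    [F W] is uniform, a given pair is such a near tie in the [s]-tail with
    probability at most [2 s^2 / M] ([prob_near_tie]).  Over the [n^2] pairs
    this makes
    [O(k^2 / M) = O(k^(2 + gamma/2) n^(-gamma/2) sqrt (log n))],
    which tends to 0 by the growth condition on [k] ([growth_powR]).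

    The degrees.  [degree_chernoff] is the Chernoff bound on an event of the
    sigma-algebra of the ordered weights.  The integer [m] depends on the
    weights; the space is cut according to the first suitable value of [m], a
    partition into events of that sigma-algebra, so that the bound is only
    needed with constant thresholds and constant exponential parameters
    ([prob_misplaced], [prob_degree_inversion]).

    The models.  Poisson edges satisfy the required domination for all
    parameters.  Truncated Bernoulli edges satisfy it for the upper tails, and
    for the lower tails provided that no truncation takes place, which holds
    when [w_1^2 <= L].  When [alpha > 2] regular variation gives
    [U t = O(t^g)] with [g < 1/2], hence [w_1 = o(sqrt n)], while [L] is at
    least of order [n] ([tail_quantile_small], [chung_lu_tame]). *)

(** * Order statistics *)

Lemma card_ord_lt n m : (m <= n)%N -> #|[set j : 'I_n | (j < m)%N]%SET| = m.
Proof.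
move=> mn; rewrite cardsE -sum1_card.
by rewrite -(big_ord_widen _ (fun=> 1%N) mn) sum1_card card_ord.
Qed.

Section order_statistics.
Variables (R : realType) (n : nat).
Implicit Types (w : 'I_n -> R) (i j : 'I_n) (x : R).

Lemma order_stat_perm w :
  exists p : {perm 'I_n}, forall i, order_stat w i = w (p i).
Proof.
pose s := sort (relpre w >=%R) (enum 'I_n).
have ss : size s = n by rewrite size_sort size_enum_ord.
have s_inj : injective (fun i : 'I_n => nth i s i).
  move=> i j ij; apply/val_inj/eqP.
  rewrite -(nth_uniq i (s := s)) ?ss ?sort_uniq ?enum_uniq ?(ltn_ord i) ?(ltn_ord j)//.
  by apply/eqP; rewrite ij; apply: set_nth_default; rewrite ss.
exists (perm s_inj) => i; rewrite permE /order_stat /codom /image_mem.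
by rewrite sort_map (nth_map i) ?ss.
Qed.

Lemma order_stat_le w i j : (i <= j)%N -> order_stat w j <= order_stat w i.
Proof.
move=> ij; rewrite /order_stat.
apply: (@sorted_leq_nth _ >=%R); rewrite ?inE ?size_sort ?size_codom ?card_ord//.
- by move=> x y z /= yx zy; exact: le_trans zy yx.
- by move=> x /=.
- by apply: sort_sorted => x y; exact: le_total.
Qed.

(** Turns events about one order statistic into events about the number of
    large values, for which independence can be used. *)
Lemma order_stat_gt w x i :
  (x < order_stat w i) = (i < #|[set j | (x < w j)%R]%SET|)%N.
Proof.
have [p wp] := order_stat_perm w.
have -> : #|[set j | (x < w j)%R]%SET| = #|[set j | (x < order_stat w j)%R]%SET|.
  rewrite -(card_imset [set j | (x < order_stat w j)%R]%SET (@perm_inj _ p)).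
  apply: eq_card => j; rewrite inE; apply/idP/imsetP => [xj|[j']].
    by exists ((p^-1)%g j); rewrite ?inE ?wp permKV.
  by rewrite inE wp => xj ->.
apply/idP/idP => [xi|].
  rewrite -(card_ord_lt (ltn_ord i)).
  apply/subset_leq_card/fintype.subsetP => j; rewrite !inE ltnS => ji.
  exact: lt_le_trans xi (order_stat_le w ji).
apply: contraTT; rewrite -leNgt -leqNgt => xi.
rewrite -[leqRHS](card_ord_lt (ltnW (ltn_ord i))).
apply/subset_leq_card/fintype.subsetP => j; rewrite !inE; apply: contraTT.
by rewrite -leqNgt -leNgt => ij; exact: le_trans (order_stat_le w ij) xi.
Qed.

Lemma sum_order_stat w : \sum_(i < n) order_stat w i = \sum_(i < n) w i.
Proof.
have [p wp] := order_stat_perm w.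
rewrite [RHS](reindex_inj (@perm_inj _ p))/=.
by apply: eq_bigr => i _; rewrite wp.
Qed.

End order_statistics.

(** * Quantiles and tails of the weight distribution *)

Section quantiles.
Variables (R : realType) (F : cumulativeBounded (0 : R) (1 : R)).
Hypothesis F_continuous : continuous F.
Hypothesis F_positive : forall x, x <= 0 -> F x = 0.
Implicit Types (a x y t : R).

Let F_le x y : x <= y -> F x <= F y.
Proof. exact: cumulative_is_nondecreasing. Qed.

Lemma cumulative_le1 x : F x <= 1.
Proof.
rewrite leNgt; apply/negP => F1.
have [y xy] := pinfty_ex_gt (num_real x) (cvgr_lt _ (cumulativey F) _ F1).
by rewrite ltNge F_le// ltW.
Qed.

Lemma cumulative_ge0 x : 0 <= F x.
Proof.
by have [/F_positive ->//|x0] := leP x 0; have := F_le (ltW x0); rewrite F_positive.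
Qed.

Lemma cumulative_exists_gt a : a < 1 -> exists x, a < F x.
Proof.
move=> a1; have [x _ ax] := pinfty_ex_gt (num_real 0) (cvgr_gt _ (cumulativey F) _ a1).
by exists x.
Qed.

(** Continuity of [F] makes every sublevel set a closed half-line, bounded by a
    point where the level is attained.  Hence [F W] is uniform, although [F] may
    be constant on intervals. *)
Lemma cumulative_level a : 0 <= a < 1 ->
  exists y, F y = a /\ forall x, (F x <= a) = (x <= y).
Proof.
move=> /andP[a0 a1]; pose S := [set x | F x <= a].
have [b Fb] := cumulative_exists_gt a1.
have S0 : S 0 by rewrite /S/= F_positive.
have Sb : ubound S b.
  by move=> x; rewrite /S/= => xa; rewrite leNgt; apply: contraL xa => /ltW/F_le bx; rewrite -ltNge (lt_le_trans Fb).
have b0 : 0 <= b by exact: Sb.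
have hS : has_ubound S by exists b.
have cS : closed S.
  by have /continuous_closedP/(_ _ (@closed_le R a)) := F_continuous.
have Ssup : S (sup S).
  by rewrite [S in S _](closure_id _).1//; apply: closure_sup => //; exists 0.
exists (sup S); split.
  apply/eqP; rewrite eq_le; apply/andP; split; first exact: Ssup.
  have [] := @IVT _ F 0 b a b0.
  - exact: continuous_subspaceT.
  - by rewrite F_positive// min_l ?max_r ?cumulative_ge0 ?a0 ?ltW.
  by move=> z _ za; rewrite -za; apply: F_le; apply: ub_le_sup => //; rewrite /S/= za.
move=> x; apply/idP/idP => [xa|xS]; first exact: ub_le_sup.
exact: le_trans (F_le xS) Ssup.
Qed.

Lemma quantile_le a x : 0 < a -> a <= F x -> quantile F a <= x.
Proof.
move=> a0 ax; apply: ge_inf => //; exists 0 => y /= ay.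
by rewrite leNgt; apply/negP => /ltW/F_positive Fy; move: ay; rewrite Fy leNgt a0.
Qed.

Lemma le_quantile a x : a < 1 -> F x < a -> x <= quantile F a.
Proof.
move=> a1 xa; apply: lb_le_inf; first by have [y /ltW ay] := cumulative_exists_gt a1; exists y.
move=> y /= ay; rewrite leNgt; apply: contraL ay => /ltW/F_le yx.
by rewrite -ltNge (le_lt_trans yx).
Qed.

Lemma quantile_homo a b : 0 < a -> a <= b -> b < 1 -> quantile F a <= quantile F b.
Proof.
move=> a0 ab b1; apply: lb_le_inf; first by have [y /ltW ay] := cumulative_exists_gt b1; exists y.
by move=> y /= byy; apply: quantile_le => //; exact: le_trans byy.
Qed.

Lemma quantile_ge0 a : 0 < a < 1 -> 0 <= quantile F a.
Proof. by move=> /andP[a0 a1]; apply: le_quantile => //; rewrite F_positive. Qed.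

End quantiles.

(** Bernoulli's inequality for a power with a negative exponent, from
    [ln (1 + u) <= u] and [1 + u <= exp u]. *)
Lemma powR_ge1D (R : realType) (g y : R) : 0 <= g -> 0 < y ->
  1 + g * (1 - y) <= (y^-1) `^ g.
Proof.
move=> g0 y0; rewrite /powR invr_eq0 gt_eqF//.
apply: le_trans (expR_ge1Dx _); rewrite lerD2l ler_wpM2l//.
rewrite lnV//; have := @le_ln1Dx R (y - 1).
have -> : 1 + (y - 1) = y by ring.
have -> : -1 < y - 1 by lra.
by move=> /(_ isT); lra.
Qed.

Section tail.
Variables (R : realType) (F : cumulativeBounded (0 : R) (1 : R)).
Hypothesis F_positive : forall x, x <= 0 -> F x = 0.
Implicit Types (a x y t : R).
Local Notation U := (tail_quantile F).

Let F_le x y : x <= y -> F x <= F y.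
Proof. exact: cumulative_is_nondecreasing. Qed.

Let tail_level t : 1 < t -> 0 < 1 - 1 / t < 1.
Proof.
move=> t1; have t0 : 0 < t by lra.
by rewrite div1r subr_gt0 invf_lt1// t1 gtrBl invr_gt0.
Qed.

Lemma tail_quantile_le t x : 1 < t -> 1 - 1 / t <= F x -> U t <= x.
Proof. by move=> /tail_level/andP[t0 _]; exact: quantile_le. Qed.

Lemma le_tail_quantile t x : 1 < t -> F x < 1 - 1 / t -> x <= U t.
Proof. by move=> /tail_level/andP[_ t0]; exact: le_quantile. Qed.

Lemma tail_quantile_homo s t : 1 < s -> s <= t -> U s <= U t.
Proof.
move=> s1 st; have t1 : 1 < t := lt_le_trans s1 st.
have /andP[a0 _] := tail_level s1; have /andP[_ b1] := tail_level t1.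
apply: quantile_homo => //.
by rewrite lerB// !div1r lef_pV2// posrE; lra.
Qed.

Lemma tail_quantile_ge0 t : 1 < t -> 0 <= U t.
Proof. by move=> /tail_level; exact: quantile_ge0. Qed.

Section lower_bound.
Variables (g t0 eta : R).
Hypotheses (g_gt0 : 0 < g) (eta_ge0 : 0 <= eta) (eta_lt1 : eta < 1).
Hypothesis U_lb : forall t x, t0 <= t -> 1 <= x ->
  (1 - eta) * x `^ g + eta <= U (t * x) / U t.

Lemma tail_quantile_gt0 t : t0 <= t -> 1 < t -> 0 < U t.
Proof.
move=> t0t t1; rewrite lt_neqAle tail_quantile_ge0// andbT eq_sym.
apply/eqP => Ut; have := U_lb t0t (lexx 1).
by rewrite Ut invr0 mulr0 powR1/=; lra.
Qed.

Lemma tail_quantile_mul_ge t x : t0 <= t -> 1 < t -> 1 <= x ->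
  U t * (1 + (1 - eta) * (x `^ g - 1)) <= U (t * x).
Proof.
move=> t0t t1 x1; rewrite mulrC -ler_pdivlMr ?tail_quantile_gt0//.
by apply: le_trans (U_lb t0t x1); lra.
Qed.

(** The lower bound on the ratios [U (t x) / U t], read with [t] fixed and [x]
    large, is a polynomial lower bound on [U]. *)
Lemma tail_quantile_growth : exists c t1, [/\ 0 < c, 1 < t1, t0 <= t1 &
  forall t, t1 <= t -> c * t `^ g <= U t].
Proof.
pose t1 := Num.max t0 2; have t01 : t0 <= t1 by rewrite le_max lexx.
have t11 : 1 < t1 by rewrite lt_max ltr1n orbT.
have t10 : 0 < t1 by lra.
exists (U t1 * (1 - eta) / t1 `^ g), t1; split => //.
  by rewrite divr_gt0 ?powR_gt0// mulr_gt0 ?tail_quantile_gt0// subr_gt0.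
move=> t t1t; have := @tail_quantile_mul_ge t1 (t / t1) t01 t11.
rewrite ler_pdivlMr// mul1r [t1 * _]mulrC divfK ?gt_eqF// => /(_ t1t); apply: le_trans.
rewrite -!mulrA ler_pM2l ?tail_quantile_gt0//.
have -> : t `^ g = (t / t1) `^ g * t1 `^ g.
  by rewrite -powRM ?divfK ?gt_eqF// ?divr_ge0//; lra.
by rewrite [_^-1 * _]mulrC mulfK ?gt_eqF ?powR_gt0//; have := eta_ge0; lra.
Qed.

Lemma cumulative_lt1 x : F x < 1.
Proof.
rewrite lt_neqAle cumulative_le1 andbT; apply/eqP => Fx.
have [c [t1 [c0 t11 _ Uc]]] := tail_quantile_growth.
have Ux t : 1 < t -> U t <= x.
  by move=> t0'; apply: tail_quantile_le => //; rewrite Fx; have /andP[] := tail_level t0'; lra.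
have x0 : 0 <= x by apply: le_trans (Ux _ t11); exact: tail_quantile_ge0.
have x1c : 0 < (x + 1) / c by rewrite divr_gt0//; lra.
pose t := Num.max t1 (((x + 1) / c) `^ g^-1).
have tt1 : t1 <= t by rewrite le_max lexx.
have := Ux t; have := Uc t tt1 => Uct /(_ (lt_le_trans t11 tt1)).
rewrite leNgt => /negP; apply; apply: lt_le_trans Uct.
rewrite mulrC -ltr_pdivrMr//.
have : (((x + 1) / c) `^ g^-1) `^ g <= t `^ g.
  have tp : 0 <= t by exact: le_trans (ltW (lt_trans ltr01 t11)) tt1.
  apply: ge0_ler_powR; rewrite ?nnegrE ?powR_ge0//; first exact: ltW.
  by rewrite le_max lexx orbT.
rewrite -powRrM mulVf ?gt_eqF// powRr1 ?(ltW x1c)//. apply: lt_le_trans.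
by rewrite ltr_pM2r ?invr_gt0//; lra.
Qed.

(** The inverse form of the lower bound on [U], and the only way in which it is
    used on spacings.  With [V = 1 - F x] and [V' = 1 - F y], the bound on
    [U (1/V') / U (1/V)] gives [y / x >= 1 + (1 - eta) ((V / V')^g - 1)], and the
    right-hand side is at least [1 + (1 - eta) g (V - V') / V]. *)
Lemma cumulative_increment_le t1 x y : t0 <= t1 -> 1 < t1 ->
  1 - 1 / t1 <= F x -> x <= y ->
  (1 - eta) * g * (F y - F x) * x <= (1 - F x) * (y - x).
Proof.
move: (g_gt0) (eta_ge0) (eta_lt1) => g0 e0' e1.
move=> t01 t11 Fx xy.
have x0 : 0 < x.
  rewrite ltNge; apply/negP => /F_positive Fx0; move: Fx; rewrite Fx0.
  by have /andP[] := tail_level t11; lra.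
have [->|Fxy] := eqVneq (F y) (F x).
  by rewrite subrr mulr0 mul0r mulr_ge0// subr_ge0// cumulative_le1.
have {Fxy} : F x < F y by rewrite lt_neqAle eq_sym Fxy F_le.
have := cumulative_lt1 y.
set V := 1 - F x; set V' := 1 - F y => Fy1 Fxy.
have V0 : 0 < V by rewrite /V; lra.
have V'0 : 0 < V' by rewrite /V'; lra.
have V'V : V' < V by rewrite /V'/V; lra.
have t1V : t1 <= V^-1.
  by rewrite -[leLHS]invrK lef_pV2 ?posrE ?invr_gt0//; move: Fx; rewrite /V; lra.
have VV' : V^-1 < V'^-1 by rewrite ltf_pV2.
(* [U (1/V)] may be smaller than [x] if [F] is flat below [x], so the ratio is
   taken at [t] slightly larger than [1/V]. *)
have key t : V^-1 < t -> t <= V'^-1 -> x * ((1 - eta) * (g * (1 - V' * t))) <= y - x.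
  move=> Vt tV'; have t1t : t1 < t by exact: le_lt_trans Vt.
  have tp : 0 < t by lra.
  have V't0 : 0 < V' * t by rewrite mulr_gt0.
  have xU : x <= U t.
    apply: le_tail_quantile; first lra.
    by rewrite ltrBrDl -ltrBrDr div1r -/V invf_plt// posrE.
  have Uy : U V'^-1 <= y.
    apply: tail_quantile_le; first lra.
    by rewrite div1r invrK /V'; lra.
  have := @tail_quantile_mul_ge t (V' * t)^-1.
  have -> : t * (V' * t)^-1 = V'^-1 by rewrite invfM mulrCA divff ?mulr1 ?gt_eqF.
  have -> : 1 <= (V' * t)^-1.
    by rewrite invf_ge1// mulrC -ler_pdivlMr// div1r.
  move=> /(_ _ _ isT)/le_trans -/(_ _ _ _ Uy) h.
  have {}h := h ltac:(lra) ltac:(lra).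
  have h2 := powR_ge1D (ltW g_gt0) V't0.
  suff : x * (1 + (1 - eta) * (g * (1 - V' * t))) <= y by lra.
  apply: le_trans h; apply: ler_pM => //; first exact: ltW.
    rewrite addr_ge0// !mulr_ge0//; [lra|lra|].
    by rewrite subr_ge0 mulrC -ler_pdivlMr// div1r.
  by rewrite lerD2l ler_wpM2l//; lra.
suff h : x * ((1 - eta) * (g * (1 - V' / V))) <= y - x.
  have -> : F y - F x = V - V' by rewrite /V /V'; lra.
  rewrite -ler_pdivrMl//; apply: le_trans h.
  rewrite le_eqVlt; apply/orP; left; apply/eqP.
  by field; rewrite gt_eqF.
apply/ler_addgt0Pr => e e0.
pose C := x * ((1 - eta) * (g * V')).
have C0 : 0 < C by rewrite /C !mulr_gt0//; lra.
pose d := Num.min (V'^-1 - V^-1) (e / C).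
have d0 : 0 < d by rewrite lt_min divr_gt0// subr_gt0 VV'.
have := key (V^-1 + d); rewrite ltrDl d0 => /(_ isT).
have -> : V^-1 + d <= V'^-1 by rewrite -lerBrDl ge_min lexx.
move=> /(_ isT).
have : C * d <= e by rewrite -ler_pdivlMl// mulrC ge_min lexx orbT.
by rewrite /C; lra.
Qed.

End lower_bound.

(** If [g < 1/2] then eventually [U (2 t) <= 2^g' U t] with [g < g' < 1/2], so
    that iterating the doubling gives [U t = O(t^g')].  In particular
    [U (n / d) < e sqrt n] for large [n], which is the conclusion in terms of
    [F]. *)
Lemma tail_quantile_small g : 0 < g ->
  (U (t * 2) / U t @[t --> +oo] --> 2 `^ g) ->
  (exists t, 1 < t /\ 0 < U t) -> g < 2^-1 -> forall e d : R, 0 < e -> 0 < d ->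
  \forall n \near \oo, 1 - F (e * Num.sqrt n%:R) <= d / n%:R.
Proof.
move=> g0 U2 [s [s1 Us]] g12 e d e0 d0.
pose g' := (g + 2^-1) / 2.
have g'0 : 0 < g' by rewrite /g'; lra.
have gg' : 2 `^ g < 2 `^ g' :> R.
  by rewrite /powR pnatr_eq0/= ltr_expR ltr_pM2r ?ln_gt0 ?ltr1n// /g'; lra.
have [T [T0 UT]] := cvgr_le _ U2 _ gg'.
pose T1 := Num.max (T + 1) s.
have T11 : 1 < T1 by rewrite lt_max s1 orbT.
have UT1 t : T1 <= t -> U (t * 2) <= 2 `^ g' * U t.
  move=> T1t; have st : s <= t by apply: le_trans T1t; rewrite le_max lexx orbT.
  have Ut : 0 < U t by apply: lt_le_trans Us _; exact: tail_quantile_homo.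
  rewrite -ler_pdivrMr//; apply: UT; apply: lt_le_trans T1t.
  by rewrite lt_max ltrDl ltr01.
pose C := U (T1 * 2) / T1 `^ g'.
have C0 : 0 <= C by rewrite divr_ge0 ?powR_ge0// tail_quantile_ge0//; lra.
have UC m t : T1 <= t -> t <= T1 * 2 ^+ m.+1 -> U t <= C * t `^ g'.
  elim: m t => [|m IH] t T1t; rewrite exprS => tm.
    have T1p : 0 < T1 `^ g' by rewrite powR_gt0; lra.
    rewrite (@le_trans _ _ (C * T1 `^ g'))//; last first.
      by rewrite ler_wpM2l// ge0_ler_powR// ?nnegrE; lra.
    rewrite /C divfK ?gt_eqF//; apply: tail_quantile_homo => //; first lra.
    by move: tm; rewrite expr0 mulr1.
  have [tT|Tt] := leP t (T1 * 2).
    by apply: IH => //; rewrite expr1 || (apply: le_trans tT _; rewrite ler_wpM2l ?exprS ?ler_peMr ?exprn_ege1 ?ler1n//; lra).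
  have -> : t = t / 2 * 2 by rewrite divfK.
  have T1t2 : T1 <= t / 2 by lra.
  apply: le_trans (UT1 _ T1t2) _.
  rewrite powRM; [|lra|lra]; rewrite [_ `^ _ * 2 `^ _]mulrC mulrCA ler_wpM2l ?powR_ge0//.
  by apply: IH => //; lra.
have {}UC t : T1 <= t -> U t <= C * t `^ g'.
  move=> T1t; have [m tm] : exists m : nat, t <= T1 * 2 ^+ m.+1.
    exists (Num.truncn t); have := truncnS_gt t => /ltW/le_trans; apply.
    rewrite -[leLHS]mul1r ler_pM//; [lra|].
    by rewrite -natrX ler_nat ltnW// ltn_expl.
  exact: UC tm.
have sqrtE (n : nat) : Num.sqrt n%:R = n%:R `^ 2^-1 :> R by rewrite powR12_sqrt.
pose r := 2^-1 - g'; have r0 : 0 < r by rewrite /r /g'; lra.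
pose K := (C * d^-1 `^ g' + 1) / e.
have K0 : 0 < K by rewrite divr_gt0// ltr_wpDl// mulr_ge0// powR_ge0.
pose N := Num.max (K `^ r^-1) (T1 * d).
near=> n.
have : N <= n%:R by near: n; exact: nbhs_infty_ger.
rewrite ge_max => /andP[Kn T1n].
have n0 : 0 < n%:R :> R by apply: lt_le_trans T1n; rewrite mulr_gt0//; lra.
have tn : T1 <= n%:R / d by rewrite ler_pdivlMr.
have -> : d / n%:R = 1 / (n%:R / d) by rewrite div1r invf_div.
rewrite lerBlDr -lerBlDl leNgt; apply/negP => /le_tail_quantile.
have -> : 1 < n%:R / d by lra.
move=> /(_ isT); rewrite leNgt => /negP; apply.
apply: le_lt_trans (UC _ tn) _.
rewrite powRM ?invr_ge0// ?(ltW d0)// sqrtE.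
have -> : 2^-1 = g' + r by rewrite /r; lra.
rewrite powRD; last by rewrite (gt_eqF n0) implybT.
rewrite mulrCA [ltRHS]mulrCA ltr_pM2l ?powR_gt0// mulrC.
have : (K `^ r^-1) `^ r <= n%:R `^ r.
  by rewrite ge0_ler_powR// ?nnegrE ?powR_ge0// ltW.
rewrite -powRrM mulVf ?gt_eqF// powRr1 ?(ltW K0)//.
by rewrite /K ler_pdivrMr// => /(lt_le_trans _) h; rewrite mulrC [ltRHS]mulrC; apply: h; lra.
Unshelve. all: by end_near. Qed.

End tail.

(** * Outer bounds and the second moment method *)

Section outer_bounds.
Context d (T : measurableType d) (R : realType) (P : probability T R).
Implicit Types (E : set T) (c : R).

(** An upper bound for the outer measure: exceptional events can be estimated
    and combined without checking that they are measurable. *)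
Definition outer_le E c := exists B, [/\ measurable B, E `<=` B & (P B <= c%:E)%E].

Lemma outer_le_measurable E c : measurable E -> (P E <= c%:E)%E -> outer_le E c.
Proof. by move=> mE Ec; exists E; split. Qed.

Lemma outer_le_sub E E' c c' : E `<=` E' -> c' <= c -> outer_le E' c' -> outer_le E c.
Proof.
move=> EE' cc' [B [mB EB PB]]; exists B; split => //; first exact: subset_trans EB.
by apply: le_trans PB _; rewrite lee_fin.
Qed.

Lemma outer_leU E E' c c' : outer_le E c -> outer_le E' c' -> outer_le (E `|` E') (c + c').
Proof.
move=> [B [mB EB PB]] [B' [mB' EB' PB']]; exists (B `|` B'); split.
- exact: measurableU.
- exact: setUSS.
- by rewrite EFinD; apply: le_trans (measureU2 _ mB mB') _; exact: leeD.
Qed.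

Lemma outer_le_bigcup (I : finType) (E : I -> set T) (c : I -> R) :
  (forall i, outer_le (E i) (c i)) ->
  outer_le (\bigcup_i E i) (\sum_i c i).
Proof.
move=> Ec; have -> : \bigcup_i E i = \big[setU/set0]_(i <- enum I) E i.
  rewrite -bigcup_seq; apply/seteqP; split => [w [i _ Ei]|w [i _ Ei]]; exists i => //=.
  by rewrite mem_enum.
rewrite [X in outer_le _ X](_ : _ = \sum_(i <- enum I) c i); last by rewrite big_enum.
elim: (enum I) => [|i s IH].
  by rewrite !big_nil; exists set0; split; rewrite ?measure0.
by rewrite !big_cons; apply: outer_leU.
Qed.

Lemma outer_le_compl E c : measurable E -> outer_le (~` E) c -> ((1 - c)%:E <= P E)%E.
Proof.
move=> mE [B [mB EB PB]].
have : (P (~` E) <= c%:E)%E.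
  by apply: le_trans PB; rewrite le_measure ?inE//; exact: measurableC.
rewrite probability_setC//; have : P E \is a fin_num by exact: fin_num_measure.
by move=> /fineK <-; rewrite -EFinB !lee_fin; lra.
Qed.

Lemma expect_indic (A : set T) : measurable A -> (\int[P]_w ((\1_A w)%:E : \bar R) = P A)%E.
Proof. by move=> mA; rewrite integral_indic// setIT. Qed.

Lemma expect_cst c : (\int[P]_w (c%:E : \bar R) = c%:E)%E.
Proof.
rewrite integral_cst// -[RHS]mule1; congr (_ * _)%E; exact: probability_setT.
Qed.

(** Pairwise independence is all that Chebyshev's inequality requires.  Rather
    than the variance, the inequality
    [(n p)^2/4 1_E + 2 n p N <= N^2 + (n p)^2] is integrated, [N] being the number
    of events that occur; all its terms are nonnegative. *)
Lemma chebyshev_events n (A : 'I_n -> set T) (p : R) : 0 < p -> (0 < n)%N ->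
  (forall j, measurable (A j)) -> (forall j, P (A j) = p%:E) ->
  (forall j l, j != l -> P (A j `&` A l) = (p ^+ 2)%:E) ->
  outer_le [set w | \sum_(j < n) (\1_(A j) w : R) <= n%:R * p / 2]
    (4 / (n%:R * p)).
Proof.
move=> p0 n0 mA PA PAA.
have nR : 0 < n%:R :> R by rewrite ltr0n.
pose N w := \sum_(j < n) (\1_(A j) w : R).
have mN : measurable_fun setT N by apply: measurable_sum => j; exact: measurable_indic.
set E := [set w | _].
have mE : measurable E.
  rewrite [E](_ : _ = N @^-1` `]-oo, n%:R * p / 2]); last first.
    by apply/seteqP; split => w; rewrite /= in_itv.
  by rewrite -[X in measurable X]setTI; exact: mN.
pose c := n%:R ^+ 2 * p ^+ 2 / 4.
have c0 : 0 < c by rewrite /c divr_gt0// mulr_gt0// exprn_gt0.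
have intN : (\int[P]_w (N w)%:E = (n%:R * p)%:E)%E.
  under eq_integral do rewrite /N -sumEFin.
  rewrite ge0_integral_sum//; last by move=> j; exact/measurable_EFinP/measurable_indic.
  under eq_bigr do rewrite expect_indic// PA.
  by rewrite sumEFin sumr_const card_ord -[LHS]/((p *+ n)%:E) mulr_natl.
have N2E w : N w ^+ 2 = \sum_(jl : 'I_n * 'I_n) (\1_(A jl.1 `&` A jl.2) w : R).
  rewrite expr2 /N big_distrlr/= pair_big/=.
  by apply: eq_bigr => jl _; rewrite indicI.
have intN2 : (\int[P]_w (N w ^+ 2)%:E <= (n%:R * p + n%:R ^+ 2 * p ^+ 2)%:E)%E.
  under eq_integral do rewrite N2E -sumEFin.
  have mAA (jl : 'I_n * 'I_n) : measurable (A jl.1 `&` A jl.2) by exact: measurableI.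
  rewrite ge0_integral_sum//; last by move=> j; exact/measurable_EFinP/measurable_indic.
  under eq_bigr do rewrite expect_indic//.
  rewrite -(pair_big predT predT (fun j l => P (A j `&` A l)))/=.
  apply: (@le_trans _ _ (\sum_(j < n) (p + n%:R * p ^+ 2)%:E)%E); last first.
    by rewrite sumEFin lee_fin sumr_const card_ord -[leLHS]mulr_natl mulrDr [n%:R ^+ 2]expr2 mulrA.
  apply: lee_sum => j _; rewrite (bigD1 j)//= setIid PA EFinD leeD//.
  apply: (@le_trans _ _ (\sum_(l < n) (p ^+ 2)%:E)%E); last first.
    by rewrite sumEFin lee_fin sumr_const card_ord -[leLHS]mulr_natl.
  rewrite [leRHS](bigD1 j)//= -[leLHS]add0e; apply: leeD; first by rewrite lee_fin sqr_ge0.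
  by apply: lee_sum => l lj; rewrite PAA// eq_sym.
have key : (c%:E * P E + (2 * (n%:R * p) * (n%:R * p))%:E <=
    (n%:R * p + 2 * (n%:R ^+ 2 * p ^+ 2))%:E)%E.
  have -> : (c%:E * P E + (2 * (n%:R * p) * (n%:R * p))%:E =
      \int[P]_w ((c * \1_E w)%:E + (2 * (n%:R * p) * N w)%:E))%E.
    rewrite ge0_integralD//.
    - congr (_ + _)%E.
        under eq_integral do rewrite EFinM.
        by rewrite ge0_integralZl ?expect_indic//; [exact/measurable_EFinP/measurable_indic|rewrite lee_fin ltW].
      under eq_integral do rewrite EFinM.
      rewrite ge0_integralZl ?intN ?EFinM//; first exact/measurable_EFinP.
        by move=> w _; rewrite lee_fin sumr_ge0.
      by rewrite lee_fin !mulr_ge0// ltW.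
    - by move=> w _; rewrite lee_fin mulr_ge0// ltW.
    - by apply/measurable_EFinP/measurable_funM => //; exact: measurable_indic.
    - by move=> w _; rewrite lee_fin mulr_ge0 ?sumr_ge0// !mulr_ge0// ltW.
    - by apply/measurable_EFinP/measurable_funM.
  apply: (@le_trans _ _ (\int[P]_w ((N w ^+ 2)%:E + (n%:R ^+ 2 * p ^+ 2)%:E))%E).
    apply: ge0_le_integral => //.
    - move=> w _; rewrite -EFinD lee_fin addr_ge0// ?mulr_ge0 ?sumr_ge0 ?(ltW c0)//; exact: ltW.

    - apply: emeasurable_funD; apply/measurable_EFinP/measurable_funM => //; exact: measurable_indic.
    - by apply: emeasurable_funD => //; apply/measurable_EFinP; exact: measurable_funX.
    - move=> w _; rewrite -!EFinD lee_fin.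
      have : 0 <= (N w - n%:R * p) ^+ 2 by exact: sqr_ge0.
      rewrite indicE; case: (boolP (w \in E)) => /=; last by nra.
      rewrite inE /E/= -/(N w) => NE _.
      have h : 0 <= N w by rewrite sumr_ge0.
      have h2 : 0 < n%:R * p by rewrite mulr_gt0.
      by rewrite /c -!exprMn; nra.
  rewrite ge0_integralD//.
  - by rewrite expect_cst (_ : 2 * _ = n%:R ^+ 2 * p ^+ 2 + n%:R ^+ 2 * p ^+ 2); [rewrite addrA EFinD leeD|ring].
  - by move=> w _; rewrite lee_fin sqr_ge0.
  - by apply/measurable_EFinP; exact: measurable_funX.
  - by move=> w _; rewrite lee_fin mulr_ge0 ?sqr_ge0.
apply: outer_le_measurable => //.
have : P E \is a fin_num by exact: fin_num_measure.
move: key => /[swap] /fineK <-; rewrite -EFinM -EFinD !lee_fin => key.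
rewrite ler_pdivlMr ?mulr_gt0//.
have h2 : 0 < n%:R * p by rewrite mulr_gt0.
rewrite -(ler_pM2r h2); move: key; rewrite /c; nra.
Qed.

End outer_bounds.

(** * Near ties between independent weights *)

Section iid.
Context d (T : measurableType d) (R : realType) (P : probability T R) (n : nat).
Variables (F : cumulativeBounded (0 : R) (1 : R)) (W : 'I_n -> {RV P >-> R}).
Hypothesis F_continuous : continuous F.
Hypothesis F_positive : forall x, x <= 0 -> F x = 0.
Hypothesis W_iid : iid_weights F W.
Implicit Types (i j l : 'I_n) (x y a b s : R).

Lemma measurable_weight_preimage i (B : set R) : measurable B -> measurable (W i @^-1` B).
Proof. by move=> mB; rewrite -[X in measurable X]setTI; exact: measurable_funPT. Qed.

Lemma prob_weight_le i x : P (W i @^-1` `]-oo, x]) = (F x)%:E.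
Proof. exact: W_iid.2. Qed.

Lemma prob_weight_gt i x : P (W i @^-1` `]x, +oo[) = (1 - F x)%:E.
Proof.
have -> : W i @^-1` `]x, +oo[ = ~` (W i @^-1` `]-oo, x]).
  by rewrite preimage_setC setCitvl.
rewrite probability_setC; last exact: measurable_weight_preimage.
by rewrite prob_weight_le EFinB.
Qed.

Lemma prob_weight_pair i j (B C : set R) : i != j -> measurable B -> measurable C ->
  P ((W i @^-1` B) `&` (W j @^-1` C)) = (P (W i @^-1` B) * P (W j @^-1` C))%E.
Proof.
move=> ij mB mC; have := W_iid.1 [set i; j]%SET (fun k => if k == i then B else C).
have -> : \bigcap_(k in [set` [set i; j]%SET])
    ((W k : T -> R) @^-1` (if k == i then B else C)) = (W i @^-1` B) `&` (W j @^-1` C).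
  apply/seteqP; split => [w h|w [wB wC] k /=].
    split; first by have := h i; rewrite /= eqxx; apply; rewrite !inE eqxx.
    by have := h j; rewrite /= eq_sym (negbTE ij); apply; rewrite !inE eqxx orbT.
  by rewrite !inE => /orP[] /eqP ->; rewrite ?eqxx// eq_sym (negbTE ij).
move=> ->; last by move=> k; case: ifP.
by rewrite big_setU1 ?inE//= big_set1 eqxx eq_sym (negbTE ij).
Qed.

Lemma measurable_cumulative : measurable_fun setT F.
Proof. by apply: nondecreasing_measurable => //; exact: cumulative_is_nondecreasing. Qed.

Definition level_band a b := F @^-1` `]a, b].

Lemma measurable_level_band a b : measurable (level_band a b).
Proof. by rewrite -[X in measurable X]setTI; exact: measurable_cumulative. Qed.

Lemma prob_level_band i a b : 0 <= a < 1 -> a <= b ->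
  (P (W i @^-1` level_band a b) <= (b - a)%:E)%E.
Proof.
move=> a01 ab; have [y [Fy yP]] := cumulative_level F_continuous F_positive a01.
have [b1|b1] := ltP b 1; last first.
  apply: (@le_trans _ _ (P (W i @^-1` `]y, +oo[))).
    apply: le_measure; rewrite ?inE.
    - by apply: measurable_weight_preimage; exact: measurable_level_band.
    - exact: measurable_weight_preimage.
    - by move=> w; rewrite /level_band /= !in_itv/= andbT ltNge yP -ltNge => /andP[].
  by rewrite prob_weight_gt Fy lee_fin; lra.
have b01 : 0 <= b < 1 by rewrite b1 andbT; lra.
have [z [Fz zP]] := cumulative_level F_continuous F_positive b01.
have := measurable_weight_preimage i (measurable_itv `]-oo, y]) => my.
have := measurable_weight_preimage i (measurable_itv `]-oo, z]) => mz.
have -> : W i @^-1` level_band a b = (W i @^-1` `]-oo, z]) `\` (W i @^-1` `]-oo, y]).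
  apply/seteqP; split => w; rewrite /level_band /= !in_itv/= zP ltNge yP.
    by move=> /andP[/negP].
  by move=> [-> /negP ->].
have -> : (P (W i @^-1` `]-oo, z] `\` W i @^-1` `]-oo, y]) =
    P (W i @^-1` `]-oo, z]) - P (W i @^-1` `]-oo, z] `&` W i @^-1` `]-oo, y]))%E.
  apply: measureD => //; apply: le_lt_trans (ltry 1); exact: probability_le1.
rewrite setIidr; last first.
  by move=> w; rewrite /= !in_itv/= -yP -zP => /le_trans; apply.
by rewrite !prob_weight_le Fz Fy.
Qed.

(** [F (W i)] and [F (W j)] are independent and uniform.  Cut [(1 - s, 1]] into
    [M] cells of length [s / M].  In a near tie, if the smaller of the two values
    lies in a cell then the larger one lies in the same cell or in the next one:
    this has probability at most [(s / M) (2 s / M)], for each of the [M] cells. *)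
Lemma prob_near_tie i j s (M : nat) : i != j -> 0 < s <= 1 -> (0 < M)%N ->
  outer_le P [set w | [/\ 1 - s < F (W i w), W i w <= W j w &
                         F (W j w) - F (W i w) < s / M%:R]]
    (2 * s ^+ 2 / M%:R).
Proof.
move=> ij /andP[s0 s1] M0; have MR : 0 < M%:R :> R by rewrite ltr0n.
pose q := s / M%:R; have q0 : 0 < q by rewrite divr_gt0.
pose lo (m : 'I_M) := 1 - q * m.+1%:R.
pose I m := level_band (lo m) (lo m + q).
pose J m := level_band (lo m) (lo m + 2 * q).
have lo01 m : 0 <= lo m < 1.
  rewrite /lo subr_ge0 gtrBl mulr_gt0// ?andbT.
  rewrite /q mulrAC ler_pdivrMr// mul1r (le_trans (ler_piMl _ s1))// ler_nat.
  exact: ltn_ord.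
pose E m := (W i @^-1` I m) `&` (W j @^-1` J m).
have : outer_le P (\bigcup_m E m) (\sum_(m < M) q * (2 * q)).
  apply: outer_le_bigcup => m; apply: outer_le_measurable.
    by apply: measurableI; apply: measurable_weight_preimage; exact: measurable_level_band.
  rewrite prob_weight_pair//; try exact: measurable_level_band.
  rewrite EFinM; apply: lee_pmul => //.
    by apply: le_trans (prob_level_band i (lo01 m) _) _; rewrite ?lerDl ?(ltW q0)// addrC addKr.
  have hq : lo m <= lo m + 2 * q by rewrite lerDl mulr_ge0// ltW.
  by apply: le_trans (prob_level_band j (lo01 m) hq) _; rewrite addrC addKr.
apply: outer_le_sub; last first.
  rewrite sumr_const card_ord -mulr_natl le_eqVlt; apply/orP; left; apply/eqP.
  by rewrite /q; field; rewrite gt_eqF.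
move=> w [sF WW FF].
have F1 := cumulative_le1 F (W i w).
have u0 : 0 <= (1 - F (W i w)) / q by rewrite divr_ge0 ?subr_ge0 ?(ltW q0).
have uM : (1 - F (W i w)) / q < M%:R.
  by rewrite ltr_pdivrMr// /q mulrC divfK ?gt_eqF//; lra.
have mM : (Num.truncn ((1 - F (W i w)) / q) < M)%N.
  by rewrite -(ltr_nat R); apply: le_lt_trans uM; rewrite truncn_le.
have FW : F (W i w) <= F (W j w) by exact: cumulative_is_nondecreasing.
have := truncn_itv u0 => /andP[].
rewrite ler_pdivlMr// ltr_pdivrMr// => h1 h2.
have hm : lo (Ordinal mM) < F (W i w) <= lo (Ordinal mM) + q.
  rewrite /lo /= -natr1 mulrDr mulr1; apply/andP; split; last lra.
  by move: h2; rewrite -natr1 mulrDl mul1r; lra.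
move/andP: hm => [hm1 hm2].
exists (Ordinal mM) => //; split; rewrite /I /J /level_band /= in_itv/=.
  by rewrite hm1.
by apply/andP; split; [lra|move: FF; rewrite -/q; lra].
Qed.

End iid.

(** * Conditional Chernoff bound *)

(** Any condition on finitely many integer variables is a countable union of
    conditions that fix all their values. *)
Lemma measurable_discrete_family d (T : measurableType d) (I : finType) (X : I -> T -> nat)
    (Q : (I -> nat) -> Prop) :
  (forall i B, measurable (X i @^-1` B)) -> measurable [set w | Q (fun i => X i w)].
Proof.
move=> mX.
have -> : [set w | Q (fun i => X i w)] =
    \bigcup_(a : {ffun I -> nat}) [set w | Q a /\ forall i, X i w = a i].
  apply/seteqP; split => [w /= Qw|w [a _ [/= Qa Xa]]].
    exists [ffun i => X i w] => //; split => [|i]; last by rewrite ffunE.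
    by have -> : ([ffun i => X i w] : I -> nat) = (fun i => X i w) by apply/funext => i; rewrite ffunE.
  by have -> : (fun i => X i w) = a by apply/funext.
apply: countable_bigcupT_measurable; first exact: countableP.
move=> a; have [Qa|nQa] := pselect (Q a); last first.
  by rewrite (_ : mkset _ = set0)//; apply/seteqP; split => // w [].
rewrite (_ : mkset _ = \bigcap_(i in [set: I]) (X i @^-1` [set a i])).
  by apply: fin_bigcap_measurable => // i _; exact: mX.
by apply/seteqP; split => [w [_ Xa] i _ /=|w Xa]; [exact: Xa|split => // i; exact: Xa].
Qed.

Section conditional_chernoff.
Context d (T : measurableType d) (R : realType) (P : probability T R).

Lemma Boole_finType (I : finType) (E : I -> set T) :
  (forall i, measurable (E i)) -> (P (\bigcup_i E i) <= \sum_i P (E i))%E.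
Proof.
move=> mE; have -> : \bigcup_i E i = \big[setU/set0]_(i <- enum I) E i.
  rewrite -bigcup_seq; apply/seteqP; split => [w [i _ Ei]|w [i _ Ei]]; exists i => //=.
  by rewrite mem_enum.
rewrite -[in leRHS]big_enum/=.
elim: (enum I) => [|i s IH].
  by rewrite !big_nil measure0.
rewrite !big_cons; apply: le_trans (measureU2 _ (mE i) _) _.
  by apply: bigsetU_measurable => j _; exact: mE.
by apply: leeD.
Qed.

Lemma probability_bigcup_le (E : (set T)^nat) (c : \bar R) :
  (forall N, measurable (E N)) -> {homo E : n m / (n <= m)%N >-> n `<=` m} ->
  (forall N, P (E N) <= c)%E -> (P (\bigcup_N E N) <= c)%E.
Proof.
move=> mE Emono Ec; have mU : measurable (\bigcup_N E N) by exact: bigcup_measurable.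
have h := @nondecreasing_cvg_mu _ _ _ P _ mE mU _.
have {}h : (P \o E) x @[x --> \oo] --> P (\bigcup_N E N).
  by apply: h => n m nm; apply/subsetPset; exact: Emono.
rewrite -(cvg_lim _ h)//; apply: lime_le; first by apply/cvg_ex; eexists; exact: h.
by apply: nearW => N; exact: Ec.
Qed.

Variables (G : set (set T)) (I : finType) (X : I -> T -> nat).
Variable nu : I -> T -> nat -> R.
Hypothesis G_measurable : G `<=` measurable.
Hypothesis mX : forall i (B : set nat), measurable (X i @^-1` B).
Hypothesis nu_ge0 : forall i w a, 0 <= nu i w a.
Hypothesis X_cond : forall a : I -> nat,
  is_cond_prob P G (\bigcap_(i in [set: I]) (X i @^-1` [set a i]))
    (fun w => \prod_i nu i w (a i)).

(** Chernoff's bound, on an event [H] of the conditioning sigma-algebra.  On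
    [S] the factor [z^(k - m)] is at least 1, so that the joint conditional law
    of the [X i] may be weighted by it; summing over all the values of the
    [X i] then yields the product of the generating functions.  The sums are
    kept finite by requiring first [X i < N] for all [i], and [N] goes to
    infinity at the end. *)
Lemma conditional_chernoff (H : set T) (z e : R) (m : nat) (S : set nat) :
  G H -> 0 < z -> 0 <= e -> (forall k, S k -> z ^+ m <= z ^+ k) ->
  (forall w N, H w -> \prod_i (\sum_(a < N) z ^+ a * nu i w a) <= e) ->
  (P ([set w | S (\sum_i X i w)%N] `&` H) <= (z ^- m * e)%:E * P H)%E.
Proof.
move=> GH z0 e0 Sz He; have mH := G_measurable GH.
have zm0 : 0 < z ^- m by rewrite invr_gt0 exprn_gt0.
pose E N := [set w | S (\sum_i X i w)%N /\ forall i, (X i w < N)%N] `&` H.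
have mE N : measurable (E N).
  apply: measurableI => //.
  exact: (@measurable_discrete_family _ _ _ X
    (fun x => S (\sum_i x i)%N /\ forall i, (x i < N)%N)).
have -> : [set w | S (\sum_i X i w)%N] `&` H = \bigcup_N E N.
  apply/seteqP; split => [w [/= Sw Hw]|w [N _ [[Sw _] Hw]]//].
  exists (\max_i X i w).+1 => //; split => //; split => // i.
  by rewrite ltnS; exact: (leq_bigmax i).
apply: probability_bigcup_le => // [n p np w [[Sw Xn] Hw]|N].
  by split => //; split => // i; exact: leq_trans (Xn i) np.
pose c (a : {ffun I -> 'I_N}) := \bigcap_(i in [set: I]) (X i @^-1` [set (a i : nat)]).
have mc a : measurable (c a) by apply: fin_bigcap_measurable => // i _; exact: mX.
pose D (a : {ffun I -> 'I_N}) := if `[< S (\sum_i a i)%N >] then c a `&` H else set0.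
have mD a : measurable (D a) by rewrite /D; case: ifP => // _; exact: measurableI.
have ED : E N `<=` \bigcup_a D a.
  move=> w [[Sw Xn] Hw]; exists [ffun i => Ordinal (Xn i)] => //; rewrite /D.
  have -> : (\sum_i [ffun i => Ordinal (Xn i)] i = \sum_i X i w)%N.
    by apply: eq_bigr => i _; rewrite ffunE.
  by rewrite asboolT//; split => // i _ /=; rewrite ffunE.
have mnu (a : I -> nat) : measurable_fun H (fun w => (\prod_i nu i w (a i))%:E).
  have [_ /measurable_int + _] := X_cond a.
  exact: measurable_funS.
pose f (a : {ffun I -> 'I_N}) w := (z ^- m * \prod_i (z ^+ (a i) * nu i w (a i)))%:E.
have f0 a w : (0 <= f a w)%E.
  rewrite lee_fin mulr_ge0 ?(ltW zm0)// prodr_ge0// => i _.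
  by rewrite mulr_ge0// exprn_ge0// ltW.
have fE a w : f a w = ((z ^- m * \prod_i (z ^+ (a i)))%:E * (\prod_i nu i w (a i))%:E)%E.
  by rewrite /f big_split/= mulrA EFinM.
have mf a : measurable_fun H (f a).
  rewrite (_ : f a = fun w => ((z ^- m * \prod_i (z ^+ (a i)))%:E * (\prod_i nu i w (a i))%:E)%E).
    by apply: measurable_funeM; exact: (mnu (fun i => a i)).
  by apply/funext => w; exact: fE.
have cz a : 0 <= z ^- m * \prod_i (z ^+ (a i : 'I_N)).
  by rewrite mulr_ge0 ?(ltW zm0)// prodr_ge0// => i _; rewrite exprn_ge0// ltW.
have PD (a : {ffun I -> 'I_N}) : (P (D a) <= \int[P]_(w in H) f a w)%E.
  rewrite /D; case: ifPn => [/asboolP Sa|_]; last by rewrite measure0 integral_ge0.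
  have [_ _ <-//] := X_cond (fun i => a i : nat).
  apply: ge0_le_integral => //.
  - by move=> w _; rewrite lee_fin prodr_ge0.
  - move=> w _; rewrite fE -EFinM lee_fin ler_peMl ?prodr_ge0// prodrXr.
    by rewrite mulrC ler_pdivlMr ?exprn_gt0// mul1r Sz.
apply: (@le_trans _ _ (P (\bigcup_a D a))).
  by apply: le_measure; rewrite ?inE//; apply: fin_bigcup_measurable.
apply: le_trans (Boole_finType mD) _.
apply: (@le_trans _ _ (\sum_a \int[P]_(w in H) f a w)%E); first exact: lee_sum.
rewrite -ge0_integral_sum//.
apply: (@le_trans _ _ (\int[P]_(w in H) (z ^- m * e)%:E)%E); last first.
  by rewrite integral_cst.
apply: ge0_le_integral => //.
- by move=> w _; exact: sume_ge0.
- exact: emeasurable_sum.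
- move=> w Hw; rewrite /f sumEFin lee_fin -mulr_sumr ler_pM2l//.
  by rewrite -(bigA_distr_bigA (fun i (a : 'I_N) => z ^+ a * nu i w a)); exact: He.
Qed.

End conditional_chernoff.

(** * Edge laws and the sigma-algebra of the ordered weights *)

Section laws.
Variable R : realType.
Implicit Types (r z x : R) (law : R -> set nat -> \bar R).

(** Domination of the partial sums of the generating function at [z] by the
    value [exp (r (z - 1))] of the Poisson distribution. *)
Definition pgf_le_poisson law r z := forall N,
  \sum_(a < N) z ^+ a * fine (law r [set (a : nat)]) <= expR (r * (z - 1)).

Lemma expR_partial_sum_le x N : 0 <= x -> \sum_(a < N) x ^+ a / a`!%:R <= expR x.
Proof.
move=> x0; have := @nondecreasing_cvgn_le _ (series (exp_coeff x)) _ (is_cvg_series_exp_coeff x) N.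
rewrite /series/= big_mkord; apply.
by apply: nondecreasing_series => k _ _; exact: exp_coeff_ge0.
Qed.

Lemma poisson_pgf r z : 0 <= r -> 0 <= z ->
  pgf_le_poisson (fun r => poisson_prob r 0) r z.
Proof.
move=> r0 z0 N; have [r_gt0|] := ltP 0 r; last first.
  move=> r_le0; have -> : r = 0 by apply/eqP; rewrite eq_le r_le0.
  rewrite mul0r expR0; apply: (@le_trans _ _ (\sum_(a < N) (a == 0%N :> nat)%:R)).
    apply: ler_sum => -[[|a] aN] _; rewrite /poisson_prob ltxx diracE/=.
      by rewrite mem_set// mulr1 expr0.
    by rewrite memNset// mulr0.
  case: N => [|N]; first by rewrite big_ord0.
  by rewrite big_ord_recl/= big1 ?addr0.
rewrite mulrBr mulr1 expRD expRN -expRN.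
rewrite (eq_bigr (fun a : 'I_N => (r * z) ^+ a / a`!%:R * expR (- r))); last first.
  move=> a _; rewrite /poisson_prob r_gt0 esum_set1 ?lee_fin ?poisson_pmf_ge0//=.
  by rewrite /poisson_pmf r_gt0 exprMn; ring.
rewrite -mulr_suml ler_pM2r ?expR_gt0//.
by apply: expR_partial_sum_le; exact: mulr_ge0.
Qed.

(** The generating function is [1 + p (z - 1) <= exp (p (z - 1))] with
    [p = min r 1].  Replacing [p] by [r] is harmless if [z >= 1], and requires
    [p = r] otherwise. *)
Lemma bernoulli_pgf r z : 0 <= r -> 0 <= z -> (1 <= z \/ r <= 1) ->
  pgf_le_poisson (fun r => pushforward (bernoulli_prob (Num.min r 1)) nat_of_bool) r z.
Proof.
move=> r0 z0 zr N; pose p := Num.min r 1.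
have p0 : 0 <= p by rewrite le_min r0/=.
have p1 : p <= 1 by rewrite ge_min lexx orbT.
have pE (a : nat) : fine (pushforward (bernoulli_prob p) nat_of_bool [set a]) =
    if a is 0%N then 1 - p else if a is 1%N then p else 0.
  rewrite /pushforward /bernoulli_prob p0 p1/=.
  case: a => [|[|a]].
  - rewrite (_ : nat_of_bool @^-1` _ = [set false]) ?fsbig_set1//.
    by apply/seteqP; split => -[].
  - rewrite (_ : nat_of_bool @^-1` _ = [set true]) ?fsbig_set1//.
    by apply/seteqP; split => -[].
  - rewrite (_ : nat_of_bool @^-1` _ = set0) ?fsbig_set0//.
    by apply/seteqP; split => -[].
apply: (@le_trans _ _ (1 + p * (z - 1))).
  under eq_bigr do rewrite pE.
  case: N => [|[|N]]; rewrite ?big_ord0 ?big_ord_recl ?big_ord0/=.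
  - have -> : 1 + p * (z - 1) = (1 - p) + p * z by ring.
    by rewrite addr_ge0 ?mulr_ge0// subr_ge0.
  - have := mulr_ge0 p0 z0; rewrite expr0; lra.
  - rewrite big1 => [|a _]; last by rewrite mulr0.
    by rewrite expr0 expr1; lra.
apply: le_trans (expR_ge1Dx _) _; rewrite ler_expR.
case: zr => [z1|r1]; last by rewrite /p min_l.
by rewrite ler_wpM2r ?subr_ge0// ge_min lexx.
Qed.

End laws.

Section degrees.
Context d (T : measurableType d) (R : realType) (P : probability T R) (n : nat).
Variables (F : R -> R) (W : 'I_n -> {RV P >-> R}) (A : 'I_n -> 'I_n -> {RV P >-> nat}).
Variable law : R -> set nat -> \bar R.
Hypothesis graph : ordered_random_graph F W A law.
Implicit Types (i j : 'I_n).

Lemma measurable_edge i j (B : set nat) : measurable (A i j @^-1` B).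
Proof. by rewrite -[X in measurable X]setTI; exact: measurable_funPT. Qed.

Lemma ordered_weight_preimage i (B : set R) : measurable B ->
  sigma_ordered W (ordered_weight W i @^-1` B).
Proof.
move=> mB; apply: sub_sigma_algebra; rewrite (bigD1 i)//=; left.
by exists B => //; rewrite setTI.
Qed.

(** Gives access to the closure properties of measurable sets. *)
Lemma sigma_orderedE (H : set T) : sigma_ordered W H = @measurable _
  (g_sigma_algebraType (\big[setU/set0]_(i < n)
    preimage_set_system setT (ordered_weight W i) measurable)) H.
Proof. by []. Qed.

Lemma sigma_orderedI (H H' : set T) :
  sigma_ordered W H -> sigma_ordered W H' -> sigma_ordered W (H `&` H').
Proof. by rewrite !sigma_orderedE; exact: measurableI. Qed.

Lemma sigma_ordered_seqDU (H : (set T)^nat) :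
  (forall m, sigma_ordered W (H m)) -> forall m, sigma_ordered W (seqDU H m).
Proof.
move=> mH m; rewrite sigma_orderedE; apply: measurableD; first exact: mH.
by apply: bigsetU_measurable => j _; exact: mH.
Qed.

Lemma sigma_ordered_bigcap (H : 'I_n -> set T) :
  (forall i, sigma_ordered W (H i)) -> sigma_ordered W (\bigcap_(i in [set: 'I_n]) H i).
Proof.
by move=> mH; rewrite sigma_orderedE; apply: fin_bigcap_measurable => // i _; exact: mH.
Qed.

Lemma measurable_ordered_weight i : measurable_fun setT (ordered_weight W i).
Proof.
apply: (measurability (@RGenOInfty.G R)).
  exact: RGenOInfty.measurableE.
move=> _ [_ [x ->] <-]; rewrite setTI.
have -> : ordered_weight W i @^-1` `]x, +oo[ =
    \bigcup_(J in [set J : {set 'I_n} | (i < #|J|)%N])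
      \bigcap_(j in [set j | j \in J]) (W j @^-1` `]x, +oo[).
  apply/seteqP; split => [w|w [J /= iJ wJ]].
    rewrite /= in_itv/= andbT order_stat_gt => iw.
    exists [set j | x < W j w]%SET => //= j /=.
    by rewrite inE in_itv/= andbT.
  rewrite in_itv/= andbT order_stat_gt; apply: leq_trans iJ _.
  apply/subset_leq_card/fintype.subsetP => j jJ; rewrite inE.
  by have := wJ j jJ; rewrite /= in_itv/= andbT.
apply: fin_bigcup_measurable => // J _; apply: fin_bigcap_measurable => // j _.
by rewrite -[X in measurable X]setTI; exact: measurable_funPT.
Qed.

Lemma sigma_ordered_measurable : sigma_ordered W `<=` measurable.
Proof.
apply: smallest_sub; first exact: sigma_algebra_measurable.
apply: (big_ind (fun D : set (set T) => D `<=` measurable)) => [//|B C mB mC D [/mB|/mC]//|].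
move=> i _ _ [B mB <-].
exact: measurable_ordered_weight.
Qed.

Lemma edge_intensityC i j w : edge_intensity W i j w = edge_intensity W j i w.
Proof. by rewrite /edge_intensity [X in X / _]mulrC. Qed.

(** The edges at [i] are indexed by all the nodes [j], whereas conditional
    independence is given for the pairs [(i, j)] with [i <= j].  The map [e]
    sends [j] to its ordered pair, and [o] recovers [j] from it. *)
Lemma degree_edges_cond i (a : 'I_n -> nat) :
  is_cond_prob P (sigma_ordered W)
    (\bigcap_(j in [set: 'I_n]) (A i j @^-1` [set a j]))
    (fun w => \prod_j fine (law (edge_intensity W i j w) [set a j])).
Proof.
have [_ Asym Aind Alaw] := graph.
pose e j : 'I_n * 'I_n := if (i <= j)%N then (i, j) else (j, i).
pose o (p : 'I_n * 'I_n) := if p.1 == i then p.2 else p.1.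
have eK : cancel e o.
  move=> j; rewrite /o /e; case: leqP => ij /=; rewrite ?eqxx//.
  by case: eqP => // ji; rewrite ji ltnn in ij.
pose J := [set e j | j : 'I_n]%SET.
have JS : J \subset [set p : 'I_n * 'I_n | (p.1 <= p.2)%N]%SET.
  apply/fintype.subsetP => _ /imsetP[j _ ->]; rewrite inE /e.
  by have [ij|/ltnW ji] := leqP i j.
have := Aind J (fun p => [set a (o p)])
  (fun p w => fine (law (edge_intensity W p.1 p.2 w) [set a (o p)])) JS (fun=> I).
have h p : p \in J -> is_cond_prob P (sigma_ordered W)
    ((A p.1 p.2 : T -> nat) @^-1` [set a (o p)])
    (fun w => fine (law (edge_intensity W p.1 p.2 w) [set a (o p)])).
  by move=> /(fintype.subsetP JS); rewrite inE => /Alaw; exact.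
move=> /(_ h).
have -> : (fun w => \prod_(p in J) fine (law (edge_intensity W p.1 p.2 w) [set a (o p)])) =
    (fun w => \prod_j fine (law (edge_intensity W i j w) [set a j])).
  apply/funext => w; rewrite big_imset/=; last by move=> j k _ _; exact: (can_inj eK).
  apply: eq_bigr => j _; rewrite eK /e; case: leqP => //= _.
  by rewrite edge_intensityC.
congr (is_cond_prob _ _ _ _).
apply/seteqP; split => [w h1 j _ /=|w h1 _ /imsetP[j _ ->] /=].
  have := h1 (e j); rewrite /= eK /e; case: leqP => ij /=; last rewrite Asym.
    by apply; apply/imsetP; exists j => //; rewrite /e ij.
  by apply; apply/imsetP; exists j => //; rewrite /e leqNgt ij.
by have := h1 j Logic.I; rewrite /= eK /e; case: leqP => //= _; rewrite Asym.
Qed.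

End degrees.

(** * Degrees and thresholds *)

Section degree_tails.
Context d (T : measurableType d) (R : realType) (P : probability T R) (n : nat).
Variables (F : R -> R) (W : 'I_n -> {RV P >-> R}) (A : 'I_n -> 'I_n -> {RV P >-> nat}).
Variable law : R -> set nat -> \bar R.
Hypothesis law_ge0 : forall r B, (0 <= law r B)%E.
Hypothesis graph : ordered_random_graph F W A law.
Implicit Types (i j : 'I_n) (w : T) (H : set T).

Definition positive_weights w := forall j, 0 < ordered_weight W j w.

Definition dominated_pgf (z : R) w := forall i j, pgf_le_poisson law (edge_intensity W i j w) z.

Lemma edge_intensity_ge0 i j w : positive_weights w -> 0 <= edge_intensity W i j w.
Proof.
move=> w0; rewrite divr_ge0 ?mulr_ge0 ?(ltW (w0 _))//.
by rewrite /total_weight -sum_order_stat sumr_ge0// => k _; exact: ltW (w0 k).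
Qed.

Lemma sum_edge_intensity i w : positive_weights w ->
  \sum_j edge_intensity W i j w = ordered_weight W i w.
Proof.
move=> w0; rewrite /edge_intensity -mulr_suml -mulr_sumr /ordered_weight sum_order_stat.
rewrite mulfK// gt_eqF// -sum_order_stat (bigD1 i)//= ltr_pwDl ?w0//.
by rewrite sumr_ge0// => k _; exact: ltW (w0 k).
Qed.

Lemma degree_chernoff i H (z e : R) (m : nat) (S : set nat) :
  sigma_ordered W H -> 0 < z -> 0 <= e -> (forall k, S k -> z ^+ m <= z ^+ k) ->
  (forall w, H w -> [/\ positive_weights w, dominated_pgf z w &
     expR (ordered_weight W i w * (z - 1)) <= e]) ->
  (P ([set w | S (degree A i w)] `&` H) <= (z ^- m * e)%:E * P H)%E.
Proof.
move=> GH z0 e0 Sz He.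
apply: (@conditional_chernoff _ _ _ P (sigma_ordered W) _ (fun j => A i j)
  (fun j w a => fine (law (edge_intensity W i j w) [set a]))) => //.
- exact: sigma_ordered_measurable.
- by move=> j B; exact: measurable_edge.
- by move=> j w a; rewrite fine_ge0.
- by move=> a; exact: (degree_edges_cond graph).
move=> w N /He[w0 wz]; apply: le_trans.
rewrite -(sum_edge_intensity i w0) mulr_suml expR_sum.
apply: ler_prod => j _; rewrite wz andbT sumr_ge0// => a _.
by rewrite mulr_ge0 ?fine_ge0// exprn_ge0// ltW.
Qed.

(** Chernoff's bound with [z = 1 + u] and [u = h / (4 m)].  As
    [z^-m <= exp (m (- u + u^2))], the exponent is at most
    [m u^2 - h u <= - h^2 / (8 m)]. *)
Lemma degree_upper_tail i H (m : nat) (h : R) :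
  (forall r z, 0 <= r -> 1 <= z -> pgf_le_poisson law r z) ->
  sigma_ordered W H -> (0 < m)%N -> 0 <= h <= m%:R ->
  (forall w, H w -> positive_weights w /\ ordered_weight W i w <= m%:R - h) ->
  (P ([set w | (m <= degree A i w)%N] `&` H) <= (expR (- (h ^+ 2 / (8 * m%:R))))%:E * P H)%E.
Proof.
move=> law_up GH m0 /andP[h0 hm] wH; have mR : 0 < m%:R :> R by rewrite ltr0n.
pose u := h / (4 * m%:R); pose z := 1 + u.
have u0 : 0 <= u by rewrite divr_ge0// mulr_ge0.
have z1 : 1 <= z by rewrite lerDl.
have z0 : 0 < z by lra.
apply: le_trans (@degree_chernoff i H z (expR ((m%:R - h) * u)) m (fun k => (m <= k)%N) GH z0 (expR_ge0 _) _ _) _.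
- by move=> k mk; rewrite ler_weXn2l.
- move=> w /wH[w0 wm]; split => // [j k|].
    by apply: law_up => //; exact: edge_intensity_ge0.
  by rewrite ler_expR /z addrAC subrr add0r ler_wpM2r.
apply: lee_pmul => //; first by rewrite lee_fin mulr_ge0 ?expR_ge0// invr_ge0 exprn_ge0// ltW.
rewrite lee_fin.
have zV : z^-1 <= expR (- u + u ^+ 2).
  apply: le_trans (expR_ge1Dx _); rewrite -div1r ler_pdivrMr// /z.
  have : 0 <= u ^+ 3 by rewrite exprn_ge0.
  have -> : (1 + (- u + u ^+ 2)) * (1 + u) = 1 + u ^+ 3 by ring.
  lra.
apply: (@le_trans _ _ (expR (- u + u ^+ 2) ^+ m * expR ((m%:R - h) * u))).
  by rewrite ler_pM2r ?expR_gt0// -exprVn ler_pXn2r// ?nnegrE ?expR_ge0// invr_ge0 ltW.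
rewrite -expRM_natl -expRD ler_expR.
have -> : m%:R * (- u + u ^+ 2) + (m%:R - h) * u = m%:R * u ^+ 2 - h * u by ring.
have hE : h = 4 * m%:R * u by rewrite /u mulrC divfK// gt_eqF// mulr_gt0.
have -> : h ^+ 2 / (8 * m%:R) = 2 * m%:R * u ^+ 2.
  by rewrite {1}hE; field; rewrite gt_eqF.
rewrite hE; have : 0 <= m%:R * u ^+ 2 by rewrite mulr_ge0// exprn_ge0.
lra.
Qed.

(** The same computation with [z = 1 - u]; now [u <= 1/4] ensures
    [z^-m <= exp (m (u + 2 u^2))]. *)
Lemma degree_lower_tail i H (m : nat) (h : R) :
  sigma_ordered W H -> (0 < m)%N -> 0 <= h <= m%:R ->
  (forall w, H w -> [/\ positive_weights w, forall z, 0 <= z <= 1 -> dominated_pgf z w &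
     m%:R + h <= ordered_weight W i w]) ->
  (P ([set w | (degree A i w < m)%N] `&` H) <= (expR (- (h ^+ 2 / (8 * m%:R))))%:E * P H)%E.
Proof.
move=> GH m0 /andP[h0 hm] wH; have mR : 0 < m%:R :> R by rewrite ltr0n.
pose u := h / (4 * m%:R); pose z := 1 - u.
have u0 : 0 <= u by rewrite divr_ge0// mulr_ge0.
have u4 : u <= 1 / 4 by rewrite ler_pdivrMr ?mulr_gt0//; lra.
have z1 : z <= 1 by rewrite /z; lra.
have z0 : 0 < z by rewrite /z; lra.
apply: le_trans (@degree_chernoff i H z (expR (- ((m%:R + h) * u))) m (fun k => (k < m)%N) GH z0 (expR_ge0 _) _ _) _.
- by move=> k km; rewrite ler_wiXn2l ?(ltW z0) ?(ltnW km).
- move=> w /wH[w0 wz wm]; split => //; first by apply: wz; rewrite ltW.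
  have -> : z - 1 = - u by rewrite /z; ring.
  by rewrite ler_expR mulrN lerN2 ler_wpM2r.
apply: lee_pmul => //; first by rewrite lee_fin mulr_ge0 ?expR_ge0// invr_ge0 exprn_ge0// ltW.
rewrite lee_fin.
have zV : z^-1 <= expR (u + 2 * u ^+ 2).
  apply: le_trans (expR_ge1Dx _); rewrite -div1r ler_pdivrMr// /z.
  have -> : (1 + (u + 2 * u ^+ 2)) * (1 - u) = 1 + u ^+ 2 * (1 - 2 * u) by ring.
  by rewrite lerDl mulr_ge0 ?exprn_ge0//; lra.
apply: (@le_trans _ _ (expR (u + 2 * u ^+ 2) ^+ m * expR (- ((m%:R + h) * u)))).
  by rewrite ler_pM2r ?expR_gt0// -exprVn ler_pXn2r// ?nnegrE ?expR_ge0// invr_ge0 ltW.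
rewrite -expRM_natl -expRD ler_expR.
have hE : h = 4 * m%:R * u by rewrite /u mulrC divfK// gt_eqF// mulr_gt0.
have -> : h ^+ 2 / (8 * m%:R) = 2 * m%:R * u ^+ 2.
  by rewrite {1}hE; field; rewrite gt_eqF.
by rewrite le_eqVlt; apply/orP; left; apply/eqP; rewrite {1}hE; ring.
Qed.

Section separation.
Hypothesis law_up : forall r z, 0 <= r -> 1 <= z -> pgf_le_poisson law r z.
Variables (K : R) (tame : set T).
Hypotheses (K_ge0 : 0 <= K) (tame_G : sigma_ordered W tame).
Hypothesis tameP : forall w, tame w ->
  positive_weights w /\ forall z, 0 <= z <= 1 -> dominated_pgf z w.

(** The solution [h] of [h^2 / (8 m) = K], the exponent of the tail bounds. *)
Definition gap (m : nat) : R := Num.sqrt (8 * m%:R * K).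

Definition separated_at (i i' : 'I_n) (m : nat) : set T :=
  [set w | m%:R + gap m <= ordered_weight W i w] `&`
  [set w | ordered_weight W i' w <= m%:R - gap m] `&` tame.

Lemma separated_at_G i i' m : sigma_ordered W (separated_at i i' m).
Proof.
apply: sigma_orderedI => //; apply: sigma_orderedI.
  have := @ordered_weight_preimage _ T R P n W i _ (measurable_itv `[m%:R + gap m, +oo[).
  by congr (sigma_ordered W _); apply/seteqP; split => w; rewrite /= in_itv/= andbT.
have := @ordered_weight_preimage _ T R P n W i' _ (measurable_itv `]-oo, m%:R - gap m]).
by congr (sigma_ordered W _); apply/seteqP; split => w; rewrite /= in_itv/=.
Qed.

Lemma measurable_degrees (Q : ('I_n -> nat) -> Prop) :
  measurable [set w | Q (fun i => degree A i w)].
Proof.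
apply: (@measurable_discrete_family _ T _ (fun p : 'I_n * 'I_n => A p.1 p.2)
  (fun a => Q (fun i => (\sum_j a (i, j))%N))).
by move=> p B; exact: measurable_edge.
Qed.

Definition misplaced (i : 'I_n) (m : nat) : set T :=
  [set w | (degree A i w < m)%N \/ exists2 j : 'I_n, (i < j)%N & (m <= degree A j w)%N].

Lemma measurable_misplaced i m : measurable (misplaced i m).
Proof.
exact: (measurable_degrees (fun D => (D i < m)%N \/ exists2 j : 'I_n, (i < j)%N & (m <= D j)%N)).
Qed.

(** The union of at most [n] tail events, one for [i] and one for each [j > i]:
    if the weight of the successor [i'] of [i] is below [m - gap m] then so are
    all the weights after it. *)
Lemma prob_misplaced (i i' : 'I_n) (m : nat) H :
  sigma_ordered W H -> H `<=` separated_at i i' m -> (i' <= i.+1)%N ->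
  (P (misplaced i m `&` H) <= (n%:R * expR (- K))%:E * P H)%E.
Proof.
move=> GH Hsep ii'; have mH := sigma_ordered_measurable GH.
have [->|/set0P[w0 Hw0]] := eqVneq H set0; first by rewrite setI0 measure0 mule0.
have g0 : 0 <= gap m by exact: sqrtr_ge0.
have [[_ /= i'm] tw0] := Hsep _ Hw0.
(* Positivity of the weights forces [gap m < m], hence also [m > 0]. *)
have gm : gap m < m%:R.
  by have [/(_ i') + _] := tameP tw0; move: i'm; rewrite /=; lra.
have m0 : (0 < m)%N by rewrite -(ltr0n R); lra.
have mR : 0 < m%:R :> R by rewrite ltr0n.
have gm0 : 0 <= gap m <= m%:R by rewrite g0 ltW.
have KE : gap m ^+ 2 / (8 * m%:R) = K.
  rewrite sqr_sqrtr; last by rewrite !mulr_ge0.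
  by field; rewrite gt_eqF.
pose B j := (if j == i then [set w | (degree A j w < m)%N] else
  if (i < j)%N then [set w | (m <= degree A j w)%N] else set0) `&` H.
have mB j : measurable (B j).
  apply: measurableI => //; case: ifP => _.
    exact: (measurable_degrees (fun D => (D j < m)%N)).
  by case: ifP => _ //; exact: (measurable_degrees (fun D => (m <= D j)%N)).
have -> : misplaced i m `&` H = \bigcup_j B j.
  apply/seteqP; split => [w [[Di|[j ij Dj]] Hw]|w [j _ [+ Hw]]].
  - by exists i => //; split => //; rewrite eqxx.
  - by exists j => //; split => //; rewrite -(inj_eq val_inj) gtn_eqF// ij.
  - case: eqP => [-> Di|_]; first by split => //; left.
    by case: ifP => // ij Dj; split => //; right; exists j.
apply: le_trans (Boole_finType P mB) _.
have PH : P H \is a fin_num by exact: fin_num_measure.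
apply: (@le_trans _ _ (\sum_(j < n) ((expR (- K))%:E * P H))%E); last first.
  by rewrite -(fineK PH) -!EFinM sumEFin lee_fin sumr_const card_ord -[leLHS]mulr_natl mulrA.
apply: lee_sum => j _; rewrite /B; case: eqP => [->|_].
  rewrite -KE; apply: degree_lower_tail => // w /Hsep[[/= iw _]] tw.
  by have [? ?] := tameP tw; split.
case: ifP => [ij|_]; last by rewrite set0I measure0 mule_ge0// lee_fin expR_ge0.
rewrite -KE; apply: degree_upper_tail => // w /Hsep[[_ /= iw]] tw.
have [? _] := tameP tw; split => //; apply: le_trans iw.
by apply: order_stat_le; exact: leq_trans ij.
Qed.

(** The threshold [m] depends on the weights.  The events [H m], on which [m] is
    the first suitable threshold, are disjoint and determined by the ordered
    weights, so that the sum over [m] of the bounds proportional to [P (H m)]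
    costs nothing. *)
Lemma prob_degree_inversion (i i' : 'I_n) : (i' <= i.+1)%N ->
  outer_le P [set w | (exists m, separated_at i i' m w) /\
     exists2 j : 'I_n, (i < j)%N & (degree A i w <= degree A j w)%N]
    (n%:R * expR (- K)).
Proof.
move=> ii'; pose H := seqDU (separated_at i i').
have GH m : sigma_ordered W (H m) by apply: sigma_ordered_seqDU => k; exact: separated_at_G.
have mH m : measurable (H m) := sigma_ordered_measurable (GH m).
have HS m : H m `<=` separated_at i i' m by exact: subset_seqDU.
exists (\bigcup_m (misplaced i m `&` H m)); split.
- by apply: bigcup_measurable => m _; apply: measurableI => //; exact: measurable_misplaced.
- move=> w [sep [j ij Dij]].
  have : (\bigcup_m separated_at i i' m) w by have [m ?] := sep; exists m.
  rewrite seqDU_bigcup_eq => -[m _ Hm]; exists m => //; split => //.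
  by have [Dm|mD] := ltnP (degree A i w) m; [left|right; exists j => //; exact: leq_trans Dij].
have c0 : (0 <= (n%:R * expR (- K))%:E)%E by rewrite lee_fin mulr_ge0// expR_ge0.
apply: le_trans (generalized_Boole_inequality _ _ _) _.
- by move=> m; apply: measurableI => //; exact: measurable_misplaced.
- by apply: bigcup_measurable => m _; apply: measurableI => //; exact: measurable_misplaced.
apply: (@le_trans _ _ (\sum_(0 <= m <oo) (n%:R * expR (- K))%:E * P (H m))%E).
  by apply: lee_nneseries => // m _; exact: (prob_misplaced (GH m) (HS m)).
rewrite nneseriesZl// -measure_semi_bigcup//.
- by rewrite -[leRHS]mule1 lee_pmul//; apply: probability_le1; exact: bigcup_measurable.
- exact: trivIset_seqDU.
- exact: bigcup_measurable.
Qed.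

End separation.
End degree_tails.

(** * Error bound for a fixed number of nodes *)

(** If [a - b < 2 + 2 q sqrt a] then [a < 4 b] by the inequality between the
    arithmetic and geometric means, as [b] is at least [(2 + 4 q)^2].  Hence
    [a - b < (2 + 4 q) sqrt b], at most the gap [c b / M] provided by the
    hypotheses. *)
Lemma gap_of_ratio (R : realType) (a b y c q : R) (M : nat) :
  0 < c <= 1 -> (0 < M)%N -> 0 <= q -> 0 < y -> y <= b ->
  M%:R * (2 + 4 * q) <= c * Num.sqrt y -> c * b / M%:R <= a - b ->
  2 + 2 * q * Num.sqrt a <= a - b.
Proof.
move=> /andP[c0 c1] M0 q0 y0 yb hM hab.
have MR : 1 <= M%:R :> R by rewrite ler1n.
have b0 : 0 < b by exact: lt_le_trans yb.
have cbM : 0 < c * b / M%:R by rewrite divr_gt0 ?mulr_gt0//; lra.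
have a0 : 0 < a by lra.
set A := Num.sqrt a; set B := Num.sqrt b; set Y := Num.sqrt y.
have AE : a = A ^+ 2 by rewrite sqr_sqrtr// ltW.
have BE : b = B ^+ 2 by rewrite sqr_sqrtr// ltW.
have A0 : 0 <= A by exact: sqrtr_ge0.
have YB : Y <= B by rewrite ler_wsqrtr.
have B0 : 0 < B by rewrite sqrtr_gt0.
have Y0 : 0 <= Y by exact: sqrtr_ge0.
have hB : M%:R * (2 + 4 * q) <= c * B by apply: le_trans hM _; rewrite ler_pM2l.
have hB1 : 2 + 4 * q <= B.
  apply: (@le_trans _ _ (M%:R * (2 + 4 * q))); first by rewrite ler_peMl//; lra.
  by apply: le_trans hB _; rewrite ger_pMl.
have hcb : B * (2 + 4 * q) <= c * b / M%:R.
  rewrite ler_pdivlMr; last lra.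
  have -> : c * b = B * (c * B) by rewrite [in LHS]BE; ring.
  by rewrite -mulrA ler_pM2l// mulrC.
rewrite leNgt; apply/negP => hlt.
have h1 : 2 * q * A <= a / 2 + 2 * q ^+ 2.
  have : 0 <= (A - 2 * q) ^+ 2 by exact: sqr_ge0.
  by rewrite AE; nra.
have h2 : 4 + 4 * q ^+ 2 <= b by rewrite BE; nra.
have h3 : A <= 2 * B.
  rewrite -(ler_pXn2r (n := 2)) ?nnegrE//; last lra.
  by rewrite exprMn -AE -BE; nra.
nra.
Qed.

(** The integer [m] is the midpoint of [a] and [b], rounded down. *)
Lemma midpoint_separation (R : realType) (a b K : R) : 0 <= K -> 0 < b ->
  2 + 2 * Num.sqrt (8 * K) * Num.sqrt a <= a - b ->
  exists m : nat, m%:R + gap K m <= a /\ b <= m%:R - gap K m.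
Proof.
move=> K0 b0 hab; have q0 : 0 <= Num.sqrt (8 * K) * Num.sqrt a by rewrite mulr_ge0 ?sqrtr_ge0.
have ab0 : 0 <= (a + b) / 2 by lra.
have /andP[] := truncn_itv ab0; set m := Num.truncn _ => m1 m2.
have gm : gap K m <= Num.sqrt (8 * K) * Num.sqrt a.
  rewrite /gap -sqrtrM ?mulr_ge0// ler_wsqrtr// mulrAC ler_wpM2l ?mulr_ge0//; lra.
exists m; move: m2; rewrite -[m.+1%:R]natr1 => m2; split; lra.
Qed.

Section one_graph.
Context d (T : measurableType d) (R : realType) (P : probability T R) (n : nat).
Variables (F : cumulativeBounded (0 : R) (1 : R)) (W : 'I_n -> {RV P >-> R}).
Variable A : 'I_n -> 'I_n -> {RV P >-> nat}.
Hypothesis F_continuous : continuous F.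
Hypothesis F_positive : forall x, x <= 0 -> F x = 0.
Variable law : R -> set nat -> \bar R.
Hypothesis law_ge0 : forall r B, (0 <= law r B)%E.
Hypothesis law_up : forall r z, 0 <= r -> 1 <= z -> pgf_le_poisson law r z.
Hypothesis graph : ordered_random_graph F W A law.
Implicit Types (i j l : 'I_n) (w : T).

Lemma top_ranks_correctP (k : nat) w :
  (forall i j, (i < k)%N -> (i < j)%N -> (degree A j w < degree A i w)%N) ->
  top_ranks_correct A k w.
Proof.
move=> Dlt i ik; rewrite /degree_rank -[RHS](card_ord_lt (ltn_ord i)) -sum1dep_card [RHS]big_mkcond/=.
apply: eq_bigr => j _; rewrite ltnS; case: (leqP j i) => ji.
  have [->|ji'] := eqVneq j i; first by rewrite leqnn.
  have ltji : (j < i)%N by rewrite ltn_neqAle ji andbT.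
  by rewrite (ltnW (Dlt j i _ ltji))// (ltn_trans ltji ik).
by rewrite leqNgt Dlt.
Qed.

Lemma measurable_top_ranks (k : nat) : measurable (top_ranks_correct A k).
Proof.
exact: (measurable_degrees A (fun D => forall i : 'I_n, (i < k)%N ->
  (\sum_(j < n) (D i <= D j))%N = i.+1)).
Qed.

Lemma sum_indic_card (y : R) w :
  \sum_(j < n) (\1_(W j @^-1` `]y, +oo[) w : R) = #|[set j | (y < W j w)%R]%SET|%:R.
Proof.
rewrite -sum1dep_card natr_sum [RHS]big_mkcond/=; apply: eq_bigr => j _.
rewrite indicE; case: ifPn => yj; first by rewrite mem_set//= in_itv/= yj.
by rewrite memNset//= in_itv/= andbT; exact/negP.
Qed.

(* For the last node [next i = i], which still satisfies [next i <= i + 1]. *)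
Let next i : 'I_n := insubd i i.+1.

(** The four error terms account for untypical weights, for too few weights in
    the [s]-tail, for a near tie among the [n^2] pairs, and for a degree that
    crosses its threshold.  Outside these events the [k + 1] largest weights lie
    in the tail and are not tied, so that consecutive ones are separated by a
    threshold that the degrees respect. *)
Lemma prob_top_ranks (k : nat) (y s c K tau : R) (M : nat) (tame : set T) :
  (0 < k)%N -> 0 < s < 1 -> n%:R * s = 4 * k%:R ->
  F y = 1 - s -> (forall x, (F x <= 1 - s) = (x <= y)) ->
  0 < c <= 1 ->
  (forall x z, 1 - s <= F x -> x <= z -> c * (F z - F x) * x <= (1 - F x) * (z - x)) ->
  0 <= K -> (0 < M)%N -> M%:R * (2 + 4 * Num.sqrt (8 * K)) <= c * Num.sqrt y ->
  sigma_ordered W tame ->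
  (forall w, tame w -> positive_weights W w /\
     forall z, 0 <= z <= 1 -> dominated_pgf W law z w) ->
  outer_le P (~` tame) tau ->
  ((1 - (tau + k%:R^-1 + 2 * (n%:R * s) ^+ 2 / M%:R + n%:R ^+ 2 * expR (- K)))%:E
     <= P (top_ranks_correct A k))%E.
Proof.
move=> k0 /andP[s0 s1] nsk Fy yP c01 Finc K0 M0 hM tameG tameP tau_le.
have kR : 0 < k%:R :> R by rewrite ltr0n.
have n0 : (0 < n)%N by rewrite lt0n; apply/eqP => n0; move: nsk; rewrite n0 mul0r; lra.
have [iid _ _ _] := graph.
have y0 : 0 < y by rewrite ltNge; apply/negP => /F_positive Fy0; move: Fy; rewrite Fy0; lra.
pose few := [set w | \sum_(j < n) (\1_(W j @^-1` `]y, +oo[) w : R) <= n%:R * s / 2].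
have few_le : outer_le P few (k%:R^-1).
  have -> : k%:R^-1 = 4 / (n%:R * s) by rewrite nsk; field; rewrite gt_eqF.
  have mY j : measurable (W j @^-1` `]y, +oo[) by exact: measurable_weight_preimage.
  have PY j : P (W j @^-1` `]y, +oo[) = s%:E.
    by rewrite (prob_weight_gt iid) Fy opprB addrCA subrr addr0.
  apply: chebyshev_events => // j l jl.
  by rewrite (prob_weight_pair iid)// !PY -EFinM.
pose tie (p : 'I_n * 'I_n) := [set w | p.1 != p.2 /\
   [/\ 1 - s < F (W p.1 w), W p.1 w <= W p.2 w & F (W p.2 w) - F (W p.1 w) < s / M%:R]].
have tie_le : outer_le P (\bigcup_p tie p) (2 * (n%:R * s) ^+ 2 / M%:R).
  have -> : 2 * (n%:R * s) ^+ 2 / M%:R = \sum_(p : 'I_n * 'I_n) (2 * s ^+ 2 / M%:R).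
    by rewrite sumr_const card_prod card_ord -[RHS]mulr_natl natrM; ring.
  apply: outer_le_bigcup => p; have [pp|pp] := eqVneq p.1 p.2.
    exists set0; split => //; first by move=> w [/eqP].
    by rewrite measure0 lee_fin divr_ge0// mulr_ge0// exprn_ge0// ltW.
  apply: outer_le_sub (prob_near_tie F_continuous F_positive iid pp _ M0); last 2 first.
    exact: lexx.
    by rewrite s0 ltW.
  by move=> w [].
pose inv i := [set w | (exists m, separated_at W K tame i (next i) m w) /\
     exists2 j : 'I_n, (i < j)%N & (degree A i w <= degree A j w)%N].
have inv_le : outer_le P (\bigcup_i inv i) (n%:R ^+ 2 * expR (- K)).
  have -> : n%:R ^+ 2 * expR (- K) = \sum_(i < n) (n%:R * expR (- K)).
    by rewrite sumr_const card_ord -[RHS]mulr_natl; ring.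
  apply: outer_le_bigcup => i; apply: (prob_degree_inversion law_ge0 graph) => //.
  by rewrite /next val_insubd; case: ifP.
apply: outer_le_compl; first exact: measurable_top_ranks.
apply: outer_le_sub (lexx _) (outer_leU (outer_leU (outer_leU tau_le few_le) tie_le) inv_le).
rewrite -[X in _ `<=` X]setCK; apply: subsetC => w.
rewrite !setCU !setCK => -[[[tw nfew] ntie] ninv].
apply: top_ranks_correctP => i j ik ij; rewrite ltnNge; apply/negP => Dij.
apply: ninv; exists i => //; split; last by exists j.
have Ncard : (k < #|[set j | (y < W j w)%R]%SET|)%N.
  move: nfew; rewrite /few /= sum_indic_card nsk => /negP; rewrite -ltNge.
  have -> : 4 * k%:R / 2 = (2 * k)%:R :> R by rewrite natrM; field.
  by rewrite ltr_nat; apply: leq_ltn_trans; rewrite leq_pmull.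
have kn : (k < n)%N by apply: leq_trans Ncard _; rewrite -[leqRHS]card_ord max_card.
have nextE : next i = i.+1 :> nat by rewrite /next val_insubd (leq_ltn_trans ik kn).
have [p pE] := order_stat_perm (fun j => W j w).
have yb : y < ordered_weight W (next i) w.
  by rewrite order_stat_gt nextE; exact: leq_ltn_trans ik Ncard.
have ba : ordered_weight W (next i) w <= ordered_weight W i w.
  by apply: order_stat_le; rewrite nextE.
set b := ordered_weight W (next i) w in yb ba; set a := ordered_weight W i w in ba.
have Fb : 1 - s < F b by rewrite ltNge yP -ltNge.
have hF : s / M%:R <= F a - F b.
  rewrite leNgt; apply/negP => hF; apply: ntie; exists (p (next i), p i) => //.
  rewrite /tie /= -!pE; split => //.
  rewrite (inj_eq perm_inj); apply/eqP => /(congr1 val) /=.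
  by rewrite nextE => /eqP; rewrite gtn_eqF.
have b0 : 0 < b by exact: lt_trans yb.
have MR : 0 < M%:R :> R by rewrite ltr0n.
have hab : c * b / M%:R <= a - b.
  have := Finc b a (ltW Fb) ba => hinc.
  rewrite -(ler_pM2l s0).
  apply: (@le_trans _ _ (c * (F a - F b) * b)).
    have -> : s * (c * b / M%:R) = c * (s / M%:R) * b by ring.
    by case/andP: c01 => c0 _; rewrite ler_pM2r// ler_pM2l.
  by apply: le_trans hinc _; rewrite ler_wpM2r ?subr_ge0//; lra.
have := gap_of_ratio c01 M0 (sqrtr_ge0 _) y0 (ltW yb) hM hab.
move=> /(midpoint_separation K0 b0)[m [ma mb]].
by exists m; split.
Qed.

End one_graph.

(** * Typical weights and growth of k *)

Section tame_events.
Context d (T : measurableType d) (R : realType) (P : probability T R) (n : nat).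
Variables (F : cumulativeBounded (0 : R) (1 : R)) (W : 'I_n -> {RV P >-> R}).
Hypothesis F_continuous : continuous F.
Hypothesis F_positive : forall x, x <= 0 -> F x = 0.
Hypothesis W_iid : iid_weights F W.
Implicit Types (i j l : 'I_n) (w : T).

Lemma sigma_ordered_gt i x : sigma_ordered W [set w | x < ordered_weight W i w].
Proof.
have := @ordered_weight_preimage _ T R P n W i _ (measurable_itv `]x, +oo[).
by congr (sigma_ordered W _); apply/seteqP; split => w; rewrite /= in_itv/= andbT.
Qed.

Lemma sigma_ordered_le i x : sigma_ordered W [set w | ordered_weight W i w <= x].
Proof.
have := @ordered_weight_preimage _ T R P n W i _ (measurable_itv `]-oo, x]).
by congr (sigma_ordered W _); apply/seteqP; split => w; rewrite /= in_itv/=.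
Qed.

Lemma positive_weights_G : sigma_ordered W [set w | positive_weights W w].
Proof.
have := @sigma_ordered_bigcap _ T R P n W _ (fun j => sigma_ordered_gt j 0).
congr (sigma_ordered W _); apply/seteqP; split => w h; [|by move=> j _; exact: h].
by move=> j; exact: h.
Qed.

Lemma positive_weights_as : outer_le P (~` [set w | positive_weights W w]) 0.
Proof.
rewrite (_ : 0 = \sum_(j < n) 0); last by rewrite big1.
have := @outer_le_bigcup _ T R P _ (fun j => W j @^-1` `]-oo, 0]) (fun=> 0) _.
have h j : outer_le P (W j @^-1` `]-oo, 0]) 0.
  apply: outer_le_measurable; first exact: measurable_weight_preimage.
  by rewrite (prob_weight_le W_iid) F_positive.
move=> /(_ h); apply: outer_le_sub => // w /= /existsNP[i /negP]; rewrite -leNgt.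
have [p pE] := order_stat_perm (fun j => W j w).
by rewrite /ordered_weight pE => Wp; exists (p i) => //=; rewrite in_itv/=.
Qed.

Lemma max_weight_le x i : outer_le P (~` [set w | ordered_weight W i w <= x]) (n%:R * (1 - F x)).
Proof.
have -> : n%:R * (1 - F x) = \sum_(j < n) (1 - F x).
  by rewrite sumr_const card_ord -[RHS]mulr_natl.
have := @outer_le_bigcup _ T R P _ (fun j => W j @^-1` `]x, +oo[) (fun=> 1 - F x) _.
have h j : outer_le P (W j @^-1` `]x, +oo[) (1 - F x).
  apply: outer_le_measurable; first exact: measurable_weight_preimage.
  by rewrite (prob_weight_gt W_iid).
move=> /(_ h); apply: outer_le_sub => // w /= /negP; rewrite -ltNge.
have [p pE] := order_stat_perm (fun j => W j w).
by rewrite /ordered_weight pE => Wp; exists (p i) => //=; rewrite in_itv/= andbT.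
Qed.

Lemma quarter_weight_gt mu i : F mu = 2^-1 -> (i <= n %/ 4)%N ->
  outer_le P (~` [set w | mu < ordered_weight W i w]) (8 / n%:R).
Proof.
move=> Fmu i4; have n0 : (0 < n)%N by case: n i {i4} => // -[].
have mY j : measurable (W j @^-1` `]mu, +oo[) by exact: measurable_weight_preimage.
have PY j : P (W j @^-1` `]mu, +oo[) = 2^-1%:E.
  by rewrite (prob_weight_gt W_iid) Fmu; congr EFin; lra.
have h0 : 0 < 2^-1 :> R by lra.
have := chebyshev_events h0 n0 mY PY.
have -> : 4 / (n%:R * 2^-1) = 8 / n%:R :> R by field; rewrite pnatr_eq0 -lt0n.
have h (j l : 'I_n) : j != l -> P (W j @^-1` `]mu, +oo[ `&` W l @^-1` `]mu, +oo[) = (2^-1 ^+ 2)%:E.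
  by move=> jl; rewrite (prob_weight_pair W_iid)// !PY -EFinM.
move=> /(_ h); apply: outer_le_sub => // w /= /negP.
rewrite sum_indic_card order_stat_gt -leqNgt => Ni.
have : (#|[set j | (mu < W j w)%R]%SET| * 4 <= n)%N.
  by apply: leq_trans (leq_divM n 4); rewrite leq_mul2r; exact: leq_trans Ni i4.
by rewrite -(ler_nat R) natrM; lra.
Qed.

Lemma norros_reittu_tame : exists tame : set T, [/\ sigma_ordered W tame,
  (forall w, tame w -> positive_weights W w /\
     forall z, 0 <= z <= 1 -> dominated_pgf W (fun r => poisson_prob r 0) z w) &
  outer_le P (~` tame) 0].
Proof.
exists [set w | positive_weights W w]; split.
- exact: positive_weights_G.
- move=> w w0; split => // z /andP[z0 _] i j; apply: poisson_pgf => //.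
  exact: edge_intensity_ge0.
- exact: positive_weights_as.
Qed.

(** [mu] is a median of [F], so that [L] is at least [mu n / 4] as soon as a
    quarter of the weights exceed it.  The bound imposed on the largest weight
    is the square root of this quantity; it keeps all the edge intensities
    at most 1. *)
Lemma chung_lu_tame mu : (0 < n)%N -> F mu = 2^-1 -> exists tame : set T,
  [/\ sigma_ordered W tame,
  (forall w, tame w -> positive_weights W w /\
     forall z, 0 <= z <= 1 -> dominated_pgf W
       (fun r => pushforward (bernoulli_prob (Num.min r 1)) nat_of_bool) z w) &
  outer_le P (~` tame)
    (n%:R * (1 - F (Num.sqrt (mu / 4) * Num.sqrt n%:R)) + 8 / n%:R)].
Proof.
move=> n0 Fmu; have mu0 : 0 < mu.
  by rewrite ltNge; apply/negP => /F_positive Fmu0; move: Fmu; rewrite Fmu0; lra.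
have nR : 0 < n%:R :> R by rewrite ltr0n.
pose i0 : 'I_n := Ordinal n0.
have q_lt : (n %/ 4 < n)%N by rewrite ltn_Pdiv.
pose q : 'I_n := Ordinal q_lt.
set x := Num.sqrt (mu / 4) * Num.sqrt n%:R.
have x0 : 0 <= x by rewrite mulr_ge0 ?sqrtr_ge0.
have x2 : x ^+ 2 = mu / 4 * n%:R.
  by rewrite exprMn !sqr_sqrtr ?divr_ge0// ltW.
exists ([set w | positive_weights W w] `&` [set w | ordered_weight W i0 w <= x] `&`
  [set w | mu < ordered_weight W q w]); split.
- apply: sigma_orderedI; last exact: sigma_ordered_gt.
  by apply: sigma_orderedI; [exact: positive_weights_G|exact: sigma_ordered_le].
- move=> w [[/= w0 w1] wq]; split => // z /andP[z0 _] i j.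
  apply: bernoulli_pgf => //; first exact: edge_intensity_ge0.
  right; have le_x l : ordered_weight W l w <= x.
    by apply: le_trans w1; exact: order_stat_le.
  have hL : mu / 4 * n%:R <= total_weight W w.
    rewrite /total_weight -sum_order_stat.
    apply: (@le_trans _ _ (\sum_(l < n) (if (l < q.+1)%N then mu else 0))).
      rewrite -big_mkcond/= sumr_const cardE.
      have -> : size (enum (fun l : 'I_n => (l < q.+1)%N)) = q.+1.
        rewrite -cardE -[RHS](card_ord_lt (n := n) (m := q.+1))//.
        by apply: eq_card => l; rewrite inE.
      rewrite -[leRHS]mulr_natr mulrAC -mulrA ler_pM2l// ler_pdivrMr//.
      by rewrite -natrM ler_nat ltnW//= ltn_ceil.
    apply: ler_sum => l _; case: ifP => lq; last exact: ltW (w0 l).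
    by apply: ltW; apply: lt_le_trans wq _; exact: order_stat_le.
  have L0 : 0 < total_weight W w.
    by apply: lt_le_trans hL; rewrite mulr_gt0// divr_gt0.
  rewrite /edge_intensity ler_pdivrMr// mul1r; apply: le_trans hL; rewrite -x2 expr2.
  by apply: ler_pM => //; exact: ltW (w0 _).
- rewrite !setCI -[X in _ (X + _)]add0r.
  apply: outer_leU; last exact: quarter_weight_gt.
  by apply: outer_leU; [exact: positive_weights_as|exact: max_weight_le].
Qed.

End tame_events.

Section growth.
Variable R : realType.
Implicit Types (k n alpha gamma : R).

Lemma ratio_le_growth k n alpha : 0 < alpha -> 0 <= k -> 1 <= ln n ->
  k / n <= k * (ln n) `^ alpha / n `^ (1 / (4 * alpha + 1)).
Proof.
move=> a0 k0 ln1; have n1 : 1 <= n.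
  rewrite leNgt; apply/negP => /ltW/ln_le0; lra.
have n0 : 0 < n by lra.
apply: ler_pM => //; first by rewrite invr_ge0 ltW.
  rewrite ler_peMr// -(powRr0 (ln n)) ler_powR//; lra.
rewrite lef_pV2 ?posrE ?powR_gt0// ler1_powR//.
rewrite ler_pdivrMr; lra.
Qed.

(** This is where the exponent [1 / (4 alpha + 1)] comes from: raised to the
    power [2 + gamma/2 = (4 alpha + 1) / (2 alpha)], the growth condition controls
    [k^(2 + gamma/2) n^(-gamma/2)].  The power of the logarithm becomes
    [2 alpha + 1/2], more than the [1/2] that is needed. *)
Lemma growth_powR k n alpha gamma : 0 < alpha -> gamma = 1 / alpha -> 0 < k -> 1 <= ln n ->
  k ^+ 2 * Num.sqrt (ln n) * (k / n) `^ (gamma / 2) <=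
  (k * (ln n) `^ alpha / n `^ (1 / (4 * alpha + 1))) `^ (2 + gamma / 2).
Proof.
move=> a0 gE k0 ln1; have n1 : 1 <= n.
  rewrite leNgt; apply/negP => /ltW/ln_le0; lra.
have n0 : 0 < n by lra.
have g0 : 0 < gamma by rewrite gE divr_gt0.
have l0 : 0 <= ln n by lra.
rewrite !powRM ?mulr_ge0 ?invr_ge0 ?powR_ge0 ?(ltW k0) ?(ltW n0)//.
rewrite -[n^-1]powR_inv1 ?(ltW n0)// -[(n `^ _)^-1]powR_inv1 ?powR_ge0// -!powRrM.
rewrite powRD; last by rewrite (gt_eqF k0) implybT.
rewrite powR_mulrn ?(ltW k0)// -powR12_sqrt//.
have -> : 1 / (4 * alpha + 1) * (-1 * (2 + gamma / 2)) = -1 * (gamma / 2).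
  by rewrite gE; field; rewrite gt_eqF//=; lra.
have -> : k ^+ 2 * (ln n) `^ 2^-1 * (k `^ (gamma / 2) * n `^ (-1 * (gamma / 2))) =
   k ^+ 2 * k `^ (gamma / 2) * (ln n) `^ 2^-1 * n `^ (-1 * (gamma / 2)) by ring.
rewrite ler_pM2r ?powR_gt0// ler_pM2l ?mulr_gt0 ?exprn_gt0 ?powR_gt0//.
rewrite ler_powR// gE mulrDr.
have -> : alpha * (1 / alpha / 2) = 2^-1 by field; rewrite gt_eqF.
by rewrite lerDr mulr_ge0// ltW.
Qed.

End growth.

(** * Convergence *)

Lemma probability_cvg1 (R : realType) (d : nat -> measure_display)
    (T : forall n, measurableType (d n)) (P : forall n, probability (T n) R)
    (E : forall n, set (T n)) :
  (forall n, measurable (E n)) ->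
  (forall e : R, 0 < e -> \forall n \near \oo, ((1 - e)%:E <= P n (E n))%E) ->
  P n (E n) @[n --> \oo] --> 1%E.
Proof.
move=> mE PE; apply: cvg_EFin.
  by apply: nearW => n; exact: fin_num_measure.
apply/cvgrPdist_le => e e0; near=> n.
have PEn : ((1 - e)%:E <= P n (E n))%E by near: n; exact: PE.
have PE1 : (P n (E n) <= 1)%E by exact: probability_le1.
have : P n (E n) \is a fin_num by exact: fin_num_measure.
move: PEn PE1 => /= + + /fineK PEq; rewrite -PEq !lee_fin => h1 h2.
by rewrite ger0_norm; lra.
Unshelve. all: by end_near. Qed.

Lemma cell_count (R : realType) (z : R) : 0 < z <= 1 ->
  exists M : nat, [/\ (0 < M)%N, M%:R <= z^-1 & M%:R^-1 <= 2 * z].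
Proof.
move=> /andP[z0 z1]; have zV0 : 0 <= z^-1 by rewrite invr_ge0 ltW.
have zV1 : 1 <= z^-1 by rewrite invf_ge1.
have /andP[m1 m2] := truncn_itv zV0.
have M0 : (0 < Num.truncn z^-1)%N by rewrite truncn_gt0.
exists (Num.truncn z^-1); split => //.
have M1 : 1 <= (Num.truncn z^-1)%:R :> R by rewrite ler1n.
have hM : z^-1 <= 2 * (Num.truncn z^-1)%:R by move: m2; rewrite -[_.+1%:R]natr1; lra.
rewrite -[X in X * z]invrK -[X in _ * X]invrK -invfM lef_pV2 ?posrE ?mulr_gt0 ?invr_gt0 ?ltr0n//.
by rewrite mulrC ler_pdivrMr// mulrC.
Qed.

Section asymptotics.
Variables (R : realType) (alpha gamma : R) (F : cumulativeBounded (0 : R) (1 : R)).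
Variables (d : nat -> measure_display) (T : forall n, measurableType (d n)).
Variables (P : forall n, probability (T n) R).
Variables (W : forall n, 'I_n -> {RV (P n) >-> R}).
Variables (A : forall n, 'I_n -> 'I_n -> {RV (P n) >-> nat}) (k : nat -> nat).
Hypotheses (alpha_gt0 : 0 < alpha) (gammaE : gamma = 1 / alpha).
Hypothesis F_continuous : continuous F.
Hypothesis F_positive : forall x, x <= 0 -> F x = 0.
Hypothesis U_lower_bound : exists t0 eta : R,
      [/\ 0 < t0, 0 <= eta, eta < 1 &
          forall t x, t0 <= t -> 1 <= x ->
            tail_quantile F (t * x) / tail_quantile F t
              >= (1 - eta) * x `^ gamma + eta].
Hypothesis k_gt0 : forall n, (0 < k n)%N.
Hypothesis k_infty : k n @[n --> \oo] --> \oo.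
Hypothesis k_growth : (k n)%:R * (ln n%:R) `^ alpha / n%:R `^ (1 / (4 * alpha + 1))
                  @[n --> \oo] --> (0 : R).
Variable law : R -> set nat -> \bar R.
Hypothesis law_ge0 : forall r B, (0 <= law r B)%E.
Hypothesis law_up : forall r z, 0 <= r -> 1 <= z -> pgf_le_poisson law r z.
Hypothesis graph : forall n, ordered_random_graph F (@W n) (@A n) law.
Hypothesis tameE : forall e : R, 0 < e -> \forall n \near \oo, exists tame : set (T n),
  [/\ sigma_ordered (@W n) tame,
  (forall w, tame w -> positive_weights (@W n) w /\
     forall z, 0 <= z <= 1 -> dominated_pgf (@W n) law z w) &
  outer_le (P n) (~` tame) e].

Let growth (n : nat) : R := (k n)%:R * (ln n%:R) `^ alpha / n%:R `^ (1 / (4 * alpha + 1)).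

(** The parameters of [prob_top_ranks] are [s = 4 k / n], [K = 3 log n] and [M]
    of order [1 / z], where cells of relative size [z] are wide enough to turn
    every insufficient gap into a near tie.  The error [64 k^2 z] made by the near ties is
    then at most a constant times the sequence [growth n], which tends to 0. *)
Lemma top_ranks_cvg1 : P n (top_ranks_correct (@A n) (k n)) @[n --> \oo] --> 1%E.
Proof.
move: (alpha_gt0) (gammaE) => a0 gE.
have g0 : 0 < gamma by rewrite gE divr_gt0.
have [t0 [eta [t0_gt0 eta0 eta1 U_lb]]] := U_lower_bound.
have [c0 [t1 [c00 t11 t01 Uc]]] := tail_quantile_growth F_positive eta0 eta1 U_lb.
pose c := Num.min ((1 - eta) * gamma) 1.
have cc : 0 < (1 - eta) * gamma by rewrite mulr_gt0// subr_gt0.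
have c01 : 0 < c <= 1 by rewrite lt_min cc ltr01 ge_min lexx orbT.
have c_gt0 : 0 < c by case/andP: c01.
have Finc (s : R) : s < 1 -> s <= 1 / t1 -> forall x z, 1 - s <= F x -> x <= z ->
    c * (F z - F x) * x <= (1 - F x) * (z - x).
  move=> s1 st x z sx xz.
  have x0 : 0 < x by rewrite ltNge; apply/negP => /F_positive Fx; move: sx; rewrite Fx; lra.
  apply: le_trans (cumulative_increment_le F_positive g0 eta0 eta1 U_lb t01 t11 _ xz); last first.
    by apply: le_trans sx; lra.
  rewrite ler_pM2r// ler_wpM2r//; last by rewrite ge_min lexx.
  by rewrite subr_ge0; exact: cumulative_is_nondecreasing.
pose D : R := 2 + 4 * Num.sqrt 24.
have D0 : 0 < D by have : 0 <= Num.sqrt 24 :> R := sqrtr_ge0 _; rewrite /D; lra.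
pose B := c * Num.sqrt c0.
have B0 : 0 < B by rewrite mulr_gt0// sqrtr_gt0.
pose C := 64 * D * 4 `^ (gamma / 2) / B.
have C0 : 0 < C by rewrite !(mulr_gt0, divr_gt0)// ?powR_gt0 ?invr_gt0.
apply: probability_cvg1 => [n|e e0]; first exact: measurable_top_ranks.
have e4 : 0 < e / 4 by lra.
(* Once [growth n <= delta], the tail probability [s] is at most [1 / t1] and
   [1 / 2], there is at least one cell, and the near ties cost at most [e / 4]. *)
pose delta := Num.min (Num.min (1 / (4 * t1)) (1 / 8)) (Num.min (e / 4 / C) C^-1).
have t1_gt0 : 0 < t1 by lra.
have delta0 : 0 < delta.
  by rewrite !lt_min (divr_gt0 e4 C0) invr_gt0 C0 !div1r !invr_gt0 mulr_gt0// ltr0n.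
near=> n.
have ln1 : 1 <= ln n%:R :> R.
  rewrite -[leLHS]expRK ler_ln ?posrE ?expR_gt0//; first by near: n; exact: nbhs_infty_ger.
  by apply: lt_le_trans (expR_gt0 1) _; near: n; exact: nbhs_infty_ger.
have hd : growth n <= delta by near: n; exact: (cvgr_le _ k_growth).
have [tame [tameG tameP tau_le]] : exists tame : set (T n),
  [/\ sigma_ordered (@W n) tame,
  (forall w, tame w -> positive_weights (@W n) w /\
     forall z, 0 <= z <= 1 -> dominated_pgf (@W n) law z w) &
  outer_le (P n) (~` tame) (e / 4)] by near: n; exact: tameE.
have n4 : 4 / e <= n%:R by near: n; exact: nbhs_infty_ger.
have k4 : 4 / e <= (k n)%:R.
  by near: n; exact: (k_infty (nbhs_infty_ger (4 / e))).
have n_gt0 : 0 < n%:R :> R by apply: lt_le_trans n4; rewrite divr_gt0.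
have kR : 0 < (k n)%:R :> R by rewrite ltr0n.
move: hd; rewrite !le_min -!andbA => /and4P[hd1 hd2 hd3 hd4].
have kn := ratio_le_growth a0 (ltW kR) ln1.
pose s := 4 * (k n)%:R / n%:R : R.
have s0 : 0 < s by rewrite divr_gt0// mulr_gt0.
have sE : s = 4 * ((k n)%:R / n%:R) by rewrite /s mulrA.
have s2 : s <= 1 / 2 by move: kn hd2; rewrite -/(growth n) sE; lra.
have st1 : s <= 1 / t1.
  move: kn hd1; rewrite -/(growth n) sE => h1 h2.
  have -> : 1 / t1 = 4 * (1 / (4 * t1)) by field; lra.
  lra.
have s01 : 0 < s < 1 by rewrite s0; lra.
have level : 0 <= 1 - s < 1 by lra.
have [y [Fy yP]] := cumulative_level F_continuous F_positive level.
pose K : R := 3 * ln n%:R.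
have K0 : 0 <= K by rewrite /K; lra.
pose L := 2 + 4 * Num.sqrt (8 * K).
have L0 : 0 < L by have := sqrtr_ge0 (8 * K); rewrite /L; lra.
have LD : L <= D * Num.sqrt (ln n%:R).
  have l1 : 1 <= Num.sqrt (ln n%:R) :> R by rewrite -[leLHS]sqrtr1 ler_wsqrtr.
  have KE : 8 * K = 24 * ln n%:R by rewrite /K; ring.
  by rewrite /L /D KE sqrtrM//; lra.
pose z := s `^ (gamma / 2) * L / B.
have z0 : 0 < z by rewrite divr_gt0// mulr_gt0// powR_gt0.
have g1 : growth n <= 1.
  apply: le_trans hd2 _; lra.
have gpos : 0 < growth n by rewrite divr_gt0 ?mulr_gt0 ?powR_gt0//; lra.
have hz : 64 * (k n)%:R ^+ 2 * z <= C * growth n.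
  apply: (@le_trans _ _ (C * growth n `^ (2 + gamma / 2))); last first.
    rewrite ler_pM2l//; apply: ge1r_powR; first by rewrite gpos.
    by have := divr_gt0 g0 (ltr0n R 2); lra.
  apply: (@le_trans _ _ (C * ((k n)%:R ^+ 2 * Num.sqrt (ln n%:R) * ((k n)%:R / n%:R) `^ (gamma / 2)))).
    rewrite /z sE powRM ?divr_ge0 ?(ltW kR) ?(ltW n_gt0)//.
    set p4 := 4 `^ _; set kp := (_ / _) `^ _.
    have -> : 64 * (k n)%:R ^+ 2 * (p4 * kp * L / B) = (64 * (k n)%:R ^+ 2 * p4 * kp / B) * L by ring.
    have -> : C * ((k n)%:R ^+ 2 * Num.sqrt (ln n%:R) * kp) =
      (64 * (k n)%:R ^+ 2 * p4 * kp / B) * (D * Num.sqrt (ln n%:R)).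
      by rewrite /C -/p4; ring.
    apply: ler_wpM2l => //; rewrite divr_ge0 ?(ltW B0)// !mulr_ge0 ?powR_ge0//; exact: ltW.
  by rewrite ler_pM2l//; exact: growth_powR.
have z1 : z <= 1.
  have : C * growth n <= 1 by rewrite -ler_pdivlMl// mulr1.
  have : 1 <= (k n)%:R ^+ 2 :> R by rewrite exprn_ege1// ler1n.
  move: hz; nra.
have z01 : 0 < z <= 1 by rewrite z0.
have [M [M0 Mz Mz2]] := cell_count z01.
have hy : Num.sqrt c0 / s `^ (gamma / 2) <= Num.sqrt y.
  have sV : t1 <= s^-1.
    by rewrite -[leLHS]invrK lef_pV2 ?posrE ?invr_gt0//; move: st1; rewrite div1r//; lra.
  have : tail_quantile F s^-1 <= y.
    apply: (tail_quantile_le F_positive); first lra.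
    by rewrite div1r invrK Fy.
  move=> /(le_trans (Uc _ sV)) h.
  apply: le_trans (ler_wsqrtr h).
  rewrite sqrtrM ?(ltW c00)// -[Num.sqrt (_ `^ _)]powR12_sqrt ?powR_ge0// -powRrM.
  by rewrite -[s^-1]powR_inv1 ?(ltW s0)// -powRrM mulN1r powRN.
have hM : M%:R * L <= c * Num.sqrt y.
  apply: (@le_trans _ _ (z^-1 * L)); first by rewrite ler_wpM2r// ltW.
  have -> : z^-1 * L = c * (Num.sqrt c0 / s `^ (gamma / 2)).
    by rewrite /z /B; field; rewrite !gt_eqF ?powR_gt0 ?sqrtr_gt0.
  by rewrite ler_pM2l.
have ns : n%:R * s = 4 * (k n)%:R by rewrite /s; field; rewrite gt_eqF.
apply: le_trans (prob_top_ranks F_continuous F_positive law_ge0 law_up (graph n)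
  (k_gt0 n) s01 ns Fy yP c01 (Finc s _ st1) K0 M0 hM tameG tameP tau_le); last by lra.
rewrite lee_fin lerB// ns.
have kV : (k n)%:R^-1 <= e / 4.
  by rewrite -[leRHS]invf_div lef_pV2 ?posrE// divr_gt0.
have nV : n%:R ^+ 2 * expR (- K) <= e / 4.
  have -> : n%:R ^+ 2 * expR (- K) = n%:R^-1.
    rewrite /K expRN expRM_natl lnK ?posrE//; field; rewrite gt_eqF//.
  by rewrite -[leRHS]invf_div lef_pV2 ?posrE// divr_gt0.
have cM : 2 * (4 * (k n)%:R) ^+ 2 / M%:R <= e / 4.
  apply: (@le_trans _ _ (64 * (k n)%:R ^+ 2 * z)).
    have -> : 64 * (k n)%:R ^+ 2 * z = 2 * (4 * (k n)%:R) ^+ 2 * (2 * z) by ring.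
    by rewrite ler_wpM2l// mulr_ge0// exprn_ge0// mulr_ge0.
  by apply: le_trans hz _; rewrite mulrC -ler_pdivlMr.
lra.
Unshelve. all: by end_near. Qed.

End asymptotics.

Theorem theorem1 (R : realType) (alpha gamma : R)
    (F : cumulativeBounded (0 : R) (1 : R))
    (d : nat -> measure_display) (T : forall n, measurableType (d n))
    (P : forall n, probability (T n) R)
    (W : forall n, 'I_n -> {RV (P n) >-> R})
    (A : forall n, 'I_n -> 'I_n -> {RV (P n) >-> nat})
    (k : nat -> nat)
    (alpha_gt0 : 0 < alpha) (gammaE : gamma = 1 / alpha)
    (F_continuous : continuous F)
    (F_positive : forall x, x <= 0 -> F x = 0)
    (U_regularly_varying : forall x, 0 < x ->
      tail_quantile F (t * x) / tail_quantile F t @[t --> +oo] --> x `^ gamma)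
    (U_lower_bound : exists t0 eta : R,
      [/\ 0 < t0, 0 <= eta, eta < 1 &
          forall t x, t0 <= t -> 1 <= x ->
            tail_quantile F (t * x) / tail_quantile F t
              >= (1 - eta) * x `^ gamma + eta])
    (model : (forall n, norros_reittu F (W n) (A n)) \/
             (2 < alpha /\ forall n, chung_lu F (W n) (A n)))
    (k_gt0 : forall n, (0 < k n)%N)
    (k_infty : k n @[n --> \oo] --> \oo)
    (k_growth : (k n)%:R * (ln n%:R) `^ alpha / n%:R `^ (1 / (4 * alpha + 1))
                  @[n --> \oo] --> (0 : R)) :
  P n (top_ranks_correct (A n) (k n)) @[n --> \oo] --> 1%E.
Proof.
have [NR|[alpha2 CL]] := model.
  apply: (top_ranks_cvg1 alpha_gt0 gammaE F_continuous F_positive U_lower_bound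
    k_gt0 k_infty k_growth _ _ NR).
  - by move=> r B; exact: measure_ge0.
  - by move=> r z r0 z1; apply: poisson_pgf => //; lra.
  move=> e e0; apply: nearW => n; have [iid _ _ _] := NR n.
  have [tame [tameG tameP tame0]] := norros_reittu_tame F_positive iid.
  by exists tame; split => //; apply: outer_le_sub tame0 => //; exact: ltW.
have g0 : 0 < gamma by rewrite gammaE divr_gt0.
have g2 : gamma < 2^-1 by rewrite gammaE div1r ltf_pV2 ?posrE.
have [mu [Fmu _]] : exists y, F y = 2^-1 /\ forall x, (F x <= 2^-1) = (x <= y).
  by apply: cumulative_level => //; lra.
have mu0 : 0 < mu.
  by rewrite ltNge; apply/negP => /F_positive Fmu0; move: Fmu; rewrite Fmu0; lra.
have U_pos : exists t, 1 < t /\ 0 < tail_quantile F t.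
  have [t0 [eta [_ eta0 eta1 U_lb]]] := U_lower_bound.
  exists (Num.max t0 2).
  have t1 : 1 < Num.max t0 2 by rewrite lt_max ltr1n orbT.
  split => //; apply: (tail_quantile_gt0 F_positive U_lb) => //.
  by rewrite le_max lexx.
have q0 : 0 < Num.sqrt (mu / 4) by rewrite sqrtr_gt0 divr_gt0.
apply: (top_ranks_cvg1 alpha_gt0 gammaE F_continuous F_positive U_lower_bound
  k_gt0 k_infty k_growth _ _ CL).
- by move=> r B; exact: measure_ge0.
- by move=> r z r0 z1; apply: bernoulli_pgf => //; [lra|left].
move=> e e0; have e2 : 0 < e / 2 by lra.
have small := tail_quantile_small F_positive g0
  (U_regularly_varying 2 (ltr0n _ 2)) U_pos g2 q0 e2.
near=> n; have n_ge : 16 / e + 1 <= n%:R by near: n; exact: nbhs_infty_ger.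
have e16 : 0 < 16 / e by rewrite divr_gt0.
have n_gt0 : 0 < n%:R :> R by lra.
have n0 : (0 < n)%N by rewrite -(ltr0n R).
have [iid _ _ _] := CL n.
have [tame [tameG tameP tame_le]] := chung_lu_tame F_positive iid n0 Fmu.
exists tame; split => //; apply: outer_le_sub tame_le => //.
have -> : e = e / 2 + e / 2 by lra.
apply: lerD.
  by rewrite mulrC -ler_pdivlMr//; near: n; exact: small.
rewrite ler_pdivrMr//; have : 16 <= n%:R * e by rewrite -ler_pdivrMr//; lra.
lra.
Unshelve. all: by end_near. Qed.
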